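(* Let $\beta=(B,(B_i)_{i\in I_\beta})$ be a regular hypertope. Fix $j\in I_\beta$, assume that $X_j=\{\sigma B_j\mid \sigma\in B\}$ is finite and has at least two elements, and let $\mathcal{D}=\mathcal{D}(\beta,j,\lambda)$ be a $j$-diagonal Coxeter graph (for some label function $\lambda:\mathcal{C}^j_\beta\to\{2,3,\ldots\}\cup\{\infty\}$). Let $A=W(\mathcal{D})$, let $\alpha=(A,(A_F)_{F\in X_j})$ be its standard coset incidence system, and let $\eta:B\to\operatorname{Aut}(A)$ be the induced action. Then: (a) The twisting $\mathcal{T}(\alpha,\beta)$, with chosen representative $F_L=B_j$ of the unique $B$-orbit $L=X_j$, is a regular hypertope. (b) If $M\le A$ is invariant under $\eta(B)$ (i.e. $\eta(b)(M)=M$ for all $b\in B$), let $N=\langle\!\langle M\rangle\!\rangle_A$ be the normal closure of $M$ in $A$ and set $\widetilde\alpha=\bigl(A/N,(A_FN/N)_{F\in X_j}\bigr)$. If $\widetilde\alpha$ is a regular hypertope, then the twisting $\mathcal{T}(\widetilde\alpha,\beta)$ (with respect to the action of $B$ on $A/N$ induced by $\eta$, and $F_L=B_j$) is a regular hypertope.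
   Context: Coset incidence systems. Given a group $B$ and a family $(B_i)_{i\in I_\beta}$ of subgroups (the maximal parabolic subgroups), the coset incidence system $\beta=(B,(B_i)_{i\in I_\beta})$ has as elements of type $i$ the left cosets $bB_i$; two cosets are incident if they intersect. $B$ acts by left multiplication. For $J\subseteq I_\beta$, $B_J=\bigcap_{i\in J}B_i$ and $B_\emptyset=B$. A flag is a set of pairwise incident elements (distinct incident elements have different types), a chamber is a flag with an element of every type, and the system is an incidence geometry if every maximal flag is a chamber. Regular hypertopes. A regular hypertope is an incidence geometry that is thin (every rank-one residue has exactly two elements), residually connected (every residue of rank at least two has connected incidence graph), and has a flag-transitive automorphism group. When a coset incidence system $(B,(B_i)_{i\in I_\beta})$ is called a regular hypertope, $B$ itself is its (type-preserving) automorphism group, i.e. $B$ acts faithfully and flag-transitively (transitively on the flags of each given type set). Diagonals. A $j$-diagonal is an unordered pair $\{F_1,F_2\}$ of distinct elements of $X_j$. Two $j$-diagonals are equivalent if some $b\in B$ maps one to the other (as unordered pairs). The equivalence class is $[F_1,F_2]$, and $\mathcal{C}^j_\beta$ is the set of all classes. Diagonal Coxeter graph. $\mathcal{D}(\beta,j,\lambda)$ has vertex set $X_j$; distinct $F_1,F_2$ are joined by an edge iff $\lambda([F_1,F_2])\neq 2$, and the edge is then labelled $\lambda([F_1,F_2])$. The Coxeter group $W(\mathcal{D})$ is generated by $a_F$ ($F\in X_j$) with defining relations $a_F^2=1$ and $(a_Fa_E)^{\lambda([F,E])}=1$ for $F\ne E$ with $\lambda([F,E])<\infty$. Set $A_F=\langle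 a_E\mid E\in X_j\setminus\{F\}\rangle$; the standard coset incidence system is $\alpha=(A,(A_F)_{F\in X_j})$. The action $\eta:B\to\operatorname{Aut}(A)$ is given by $\eta(b)(a_F)=a_{bF}$. Twisting. Let $\alpha=(A,(A_i)_{i\in I_\alpha})$ and $\beta=(B,(B_i)_{i\in I_\beta})$ be coset incidence systems and $\eta:B\to\operatorname{Aut}(A)$ an action permuting the maximal parabolic subgroups of $\alpha$, so that $B$ acts on $I_\alpha$ with $\eta(b)(A_i)=A_{b\cdot i}$. Let $\mathcal{K}$ be the set of orbits on $I_\alpha$ and for each $L\in\mathcal{K}$ choose a representative $F_L\in L$. For $M\subseteq I_\beta$ put $\mathcal{O}_L(M)=B_{I_\beta\setminus M}\cdot F_L$. Then $\alpha$ is $(\beta,\eta)$-admissible if $\mathcal{O}_L(M)\cap\mathcal{O}_L(N)=\mathcal{O}_L(M\cap N)$ for all $L\in\mathcal{K}$, $M,N\subseteq I_\beta$. In that case the twisting $\mathcal{T}(\alpha,\beta)$ with respect to $\eta$ and $(F_L)_{L\in\mathcal{K}}$ is the coset incidence system $(G,(G_i)_{i\in I_\beta\sqcup\mathcal{K}})$ with $G=A\rtimes_\eta B$, $G_i=A_{\bigcup_{L\in\mathcal{K}}(L\setminus\mathcal{O}_L^i)}\rtimes B_i$ for $i\in I_\beta$, where $\mathcal{O}_L^i=B_i\cdot F_L$, and $G_L=A_L\rtimes B$ for $L\in\mathcal{K}$; here $A_J=\bigcap_{i\in J}A_i$ for $J\subseteq I_\alpha$, $A_\emptyset=A$. (That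 the admissibility condition holds is part of the assertion.) *)

(* Defs.v *)
From Stdlib Require Import Relation_Operators.
From HB Require Import structures.
From mathcomp Require Import all_boot.
From mathcomp Require Import boolp classical_sets cardinality.

Set Implicit Arguments.
Unset Strict Implicit.
Unset Printing Implicit Defensive.

Local Open Scope quotient_scope.
Local Open Scope classical_set_scope.
Local Open Scope group_scope.

Definition subgroup (G : groupType) (H : set G) : Prop :=
  H 1 /\ forall x y, H x -> H y -> H (x / y).

Definition generated (G : groupType) (S : set G) : set G :=
  \bigcap_(H in [set H | subgroup H /\ S `<=` H]) H.

Definition lcoset (G : groupType) (x : G) (H : set G) : set G :=
  [set x * h | h in H].

Definition lcosets (G : groupType) (H : set G) : set (set G) :=
  [set lcoset x H | x in setT].

Lemma subgroup1 (G : groupType) (H : set G) : subgroup H -> H 1.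
Proof. by case. Qed.

Lemma subgroupV (G : groupType) (H : set G) x : subgroup H -> H x -> H x^-1.
Proof. by case=> H1 HB Hx; rewrite -div1g; apply: HB. Qed.

Lemma subgroupM (G : groupType) (H : set G) x y :
  subgroup H -> H x -> H y -> H (x * y).
Proof.
move=> sH Hx Hy; have := subgroupV sH Hy; rewrite -[y in x * y]invgK.
by case: sH => _; apply.
Qed.

Lemma subgroup_bigcap (G : groupType) I (D : set I) (H : I -> set G) :
  (forall i, D i -> subgroup (H i)) -> subgroup (\bigcap_(i in D) H i).
Proof.
move=> sH; split=> [i Di|x y Hx Hy i Di]; first exact: (sH i Di).1.
by apply: (sH i Di).2; [apply: Hx|apply: Hy].
Qed.

Lemma generated_subgroup (G : groupType) (S : set G) : subgroup (generated S).
Proof. by apply: subgroup_bigcap => H []. Qed.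

Lemma lcosetA (G : groupType) (x y : G) (H : set G) :
  lcoset x (lcoset y H) = lcoset (x * y) H.
Proof.
apply/seteqP; split=> z /=.
  by case=> _ [h Hh <-] <-; exists h; rewrite ?mulgA.
by case=> h Hh <-; exists (y * h); [exists h|rewrite mulgA].
Qed.

Lemma lcoset1 (G : groupType) (H : set G) : lcoset 1 H = H.
Proof.
apply/seteqP; split=> z /=; first by case=> h Hh <-; rewrite mul1g.
by move=> Hz; exists z; rewrite ?mul1g.
Qed.

Record coset_system (I : Type) (G : groupType) := CosetSystem {
  parabolic :> I -> set G;
  parabolic_subgroup : forall i, subgroup (parabolic i) }.

Section CosetIncidence.
Variables (I : Type) (G : groupType) (P : coset_system I G).

(* An element is a pair (type, left coset), so that equal subsets of G
   occurring as cosets of P i and of P k with i <> k are different elements. *)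
Definition element (p : I * set G) : Prop := lcosets (P p.1) p.2.

Definition incident (p q : I * set G) : Prop := p.2 `&` q.2 !=set0.

Definition translate (g : G) (p : I * set G) : I * set G :=
  (p.1, lcoset g p.2).

Definition parabolics (J : set I) : set G := \bigcap_(i in J) P i.

Definition flag (F : set (I * set G)) : Prop :=
  F `<=` element /\ forall p q, F p -> F q -> incident p q.

Definition flag_type (F : set (I * set G)) : set I := [set p.1 | p in F].

Definition chamber (F : set (I * set G)) : Prop :=
  flag F /\ flag_type F = setT.

Definition incidence_geometry : Prop :=
  forall F, flag F -> (forall F', flag F' -> F `<=` F' -> F' = F) -> chamber F.

Definition residue (F : set (I * set G)) : set (I * set G) :=
  [set p | [/\ element p, ~ F p & forall q, F q -> incident p q]].

Definition thin : Prop :=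
  forall F, flag F -> (exists i, ~` flag_type F = [set i]) ->
  exists p q, p <> q /\ residue F = [set p; q].

Definition connected_incidence (R : set (I * set G)) : Prop :=
  forall p q, R p -> R q ->
  clos_refl_trans _ (fun x y => [/\ R x, R y & incident x y]) p q.

Definition residually_connected : Prop :=
  forall F, flag F ->
  (exists i k, [/\ i <> k, ~ flag_type F i & ~ flag_type F k]) ->
  connected_incidence (residue F).

Definition faithful : Prop :=
  forall g, (forall p, element p -> translate g p = p) -> g = 1.

Definition flag_transitive : Prop :=
  forall F F', flag F -> flag F' -> flag_type F = flag_type F' ->
  exists g, translate g @` F = F'.

(* The last two clauses say that G itself plays the role of the
   (type-preserving) flag-transitive automorphism group. *)
Definition regular_hypertope : Prop :=
  [/\ incidence_geometry, thin, residually_connected, faithful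
    & flag_transitive].

End CosetIncidence.

Record aut_action (B A : groupType) := AutAction {
  aut_act :> B -> A -> A;
  aut_act1 : forall x, aut_act 1 x = x;
  aut_actM : forall b c x, aut_act (b * c) x = aut_act b (aut_act c x);
  aut_act_mul : forall b x y, aut_act b (x * y) = aut_act b x * aut_act b y }.

Section AutActionTheory.
Variables (B A : groupType) (eta : aut_action B A).

Lemma aut_act_1 b : eta b 1 = 1.
Proof. by apply: (@mulgI _ (eta b 1)); rewrite -aut_act_mul !mulg1. Qed.

Lemma aut_actV b x : eta b x^-1 = (eta b x)^-1.
Proof. by apply: (@mulgI _ (eta b x)); rewrite -aut_act_mul !mulgV aut_act_1. Qed.

Lemma aut_act_preim_subgroup b (H : set A) :
  subgroup H -> subgroup (eta b @^-1` H).
Proof.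
move=> sH; split=> [|x y Hx Hy]; rewrite /preimage /=.
  by rewrite aut_act_1; exact: sH.1.
by rewrite aut_act_mul aut_actV; exact: sH.2.
Qed.

Lemma aut_actK b : cancel (eta b) (eta b^-1).
Proof. by move=> x; rewrite -aut_actM mulVg aut_act1. Qed.

Lemma aut_actKV b : cancel (eta b^-1) (eta b).
Proof. by move=> x; rewrite -aut_actM mulgV aut_act1. Qed.

(* Pairs (a, b) with product (a, b) (c, d) = (a * eta b c, b * d); the alias
   keeps this structure apart from the direct product on A * B. *)
Definition sdprod of aut_action B A := (A * B)%type.

HB.instance Definition _ := Choice.on (sdprod eta).

Definition sd_one : sdprod eta := (1, 1).
Definition sd_inv (g : sdprod eta) : sdprod eta := (eta g.2^-1 g.1^-1, g.2^-1).
Definition sd_mul (g h : sdprod eta) : sdprod eta := (g.1 * eta g.2 h.1, g.2 * h.2).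

Lemma sd_mulA : associative sd_mul.
Proof.
by move=> [a b] [c d] [e f]; rewrite /sd_mul /= aut_act_mul aut_actM !mulgA.
Qed.

Lemma sd_mul1 : left_id sd_one sd_mul.
Proof. by case=> a b; rewrite /sd_mul /= aut_act1 !mul1g. Qed.

Lemma sd_mulr1 : right_id sd_one sd_mul.
Proof. by case=> a b; rewrite /sd_mul /= aut_act_1 !mulg1. Qed.

Lemma sd_mulV : left_inverse sd_one sd_inv sd_mul.
Proof.
by case=> a b; rewrite /sd_mul /sd_inv /= -aut_act_mul !mulVg aut_act_1.
Qed.

Lemma sd_mulrV : right_inverse sd_one sd_inv sd_mul.
Proof. by case=> a b; rewrite /sd_mul /sd_inv /= aut_actKV !mulgV. Qed.

HB.instance Definition _ := isGroup.Build (sdprod eta)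
  sd_mulA sd_mul1 sd_mulr1 sd_mulV sd_mulrV.

End AutActionTheory.

Record parabolic_action (Ia : Type) (A B : groupType)
    (alpha : coset_system Ia A) := ParabolicAction {
  par_act :> aut_action B A;
  idx_act : B -> Ia -> Ia;
  idx_act1 : forall i, idx_act 1 i = i;
  idx_actM : forall b c i, idx_act (b * c) i = idx_act b (idx_act c i);
  par_actE : forall b i, par_act b @` alpha i = alpha (idx_act b i) }.

Definition orbits (Ia B : Type) (act : B -> Ia -> Ia) : set (set Ia) :=
  [set [set act b i | b in setT] | i in setT].

Record orbit_reps (Ia B : Type) (act : B -> Ia -> Ia) := OrbitReps {
  orbit_rep :> orbits act -> Ia;
  orbit_repP : forall L : orbits act, val L (orbit_rep L) }.

Section Twisting.
Variables (Ia Ib : Type) (A B : groupType).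
Variables (alpha : coset_system Ia A) (beta : coset_system Ib B).
Variables (eta : parabolic_action B alpha) (rep : orbit_reps (idx_act eta)).

Local Notation K := (set_type (orbits (idx_act eta))).

(* $\mathcal{O}_L(M)$, the orbit of rep L under $B_{I_\beta\setminus M}$. *)
Definition partial_orbit (L : K) (M : set Ib) : set Ia :=
  [set idx_act eta b (rep L) | b in parabolics beta (~` M)].

Definition admissible : Prop :=
  forall (L : K) (M N : set Ib),
  partial_orbit L M `&` partial_orbit L N = partial_orbit L (M `&` N).

(* The set of pairs X `*` Y is the subgroup $X \rtimes Y$ of $A \rtimes B$. *)
Definition twisting_parabolic (i : Ib + K) : set (sdprod eta) :=
  match i with
  | inl i =>
      parabolics alpha
        (\bigcup_(L in [set: K])
           (val L `\` [set idx_act eta b (rep L) | b in beta i]))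
      `*` beta i
  | inr L => parabolics alpha (val L) `*` setT
  end.

Lemma sdprod_subgroup (X : set A) (Y : set B) : subgroup X -> subgroup Y ->
  (forall b x, Y b -> X x -> X (eta b x)) ->
  subgroup (X `*` Y : set (sdprod eta)).
Proof.
move=> sX sY stab; split; first by split; exact: subgroup1.
case=> a b [c d] [/= Xa Yb] [/= Xc Yd].
have Ybd : Y (b / d) by exact: sY.2.
split=> //=; apply: subgroupM => //; apply: (stab) => //.
by apply: stab; exact: subgroupV.
Qed.

Lemma parabolics_stable (J : set Ia) b x :
  (forall i, J i -> J (idx_act eta b^-1 i)) ->
  parabolics alpha J x -> parabolics alpha J (eta b x).
Proof.
move=> stab Jx i Ji.
rewrite -[i](idx_act1 eta) -(mulgV b) idx_actM -par_actE.
by exists x => //; apply/Jx/stab.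
Qed.

Lemma orbit_stable (L : K) b i : val L i -> val L (idx_act eta b i).
Proof.
case: L => L /= /[dup] /set_mem [k _ <-] _ [c _ <-].
by exists (b * c) => //; rewrite idx_actM.
Qed.

Lemma twisting_parabolic_subgroup i : subgroup (twisting_parabolic i).
Proof.
have sJ J : subgroup (parabolics alpha J).
  by apply: subgroup_bigcap => k _; exact: parabolic_subgroup.
case: i => [i|L] /=; apply: sdprod_subgroup => //.
- exact: parabolic_subgroup.
- move=> b x Bb; apply: parabolics_stable => k [L _ [Lk nk]].
  exists L => //; split; first exact: orbit_stable.
  case=> c Bc e; apply: nk; exists (b * c).
    by apply: subgroupM => //; exact: parabolic_subgroup.
  by rewrite idx_actM e -idx_actM mulgV idx_act1.
- by move=> b x _; apply: parabolics_stable => k; exact: orbit_stable.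
Qed.

Definition twisting : coset_system (Ib + K) (sdprod eta) :=
  CosetSystem twisting_parabolic_subgroup.

End Twisting.

Arguments admissible {Ia Ib A B alpha} beta eta rep.
Arguments twisting {Ia Ib A B alpha} beta eta rep.

Record normal_subgroup (A : groupType) := NormalSubgroup {
  normal_set :> set A;
  normal_set_subgroup : subgroup normal_set;
  normal_setJ : forall x y, normal_set x -> normal_set (x ^ y) }.

Section Quotient.
Variables (A : groupType) (N : normal_subgroup A).

Definition coset_eq (x y : A) : bool := `[< normal_set N (x^-1 * y) >].

Lemma coset_eq_refl : reflexive coset_eq.
Proof.
by move=> x; apply/asboolP; rewrite mulVg; apply: subgroup1;
  exact: normal_set_subgroup.
Qed.

Lemma coset_eq_sym : symmetric coset_eq.
Proof.
have sub x y : coset_eq x y -> coset_eq y x.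
  move=> /asboolP/(subgroupV (normal_set_subgroup N)).
  by rewrite invgM invgK => ?; apply/asboolP.
by move=> x y; apply/idP/idP; exact: sub.
Qed.

Lemma coset_eq_trans : transitive coset_eq.
Proof.
move=> y x z /asboolP xy /asboolP yz; apply/asboolP.
have := subgroupM (normal_set_subgroup N) xy yz.
by rewrite -mulgA mulVKg.
Qed.

Canonical coset_equiv := EquivRel coset_eq coset_eq_refl coset_eq_sym
  coset_eq_trans.

Definition quot := {eq_quot coset_equiv}.

HB.instance Definition _ := Choice.on quot.
HB.instance Definition _ := EqQuotient.on quot.

Definition quot_proj (x : A) : quot := \pi x.

Lemma quot_projP x y : quot_proj x = quot_proj y <-> normal_set N (x^-1 * y).
Proof.
split=> [/eqmodP /asboolP //|h]; apply/eqmodP.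
exact/asboolP.
Qed.

Lemma quot_repr u : quot_proj (repr u) = u.
Proof. exact: reprK. Qed.

Definition q_one : quot := quot_proj 1.
Definition q_inv (u : quot) : quot := quot_proj (repr u)^-1.
Definition q_mul (u v : quot) : quot := quot_proj (repr u * repr v).

Lemma repr_quot_proj x : normal_set N (x^-1 * repr (quot_proj x)).
Proof. by apply/quot_projP; rewrite quot_repr. Qed.

Lemma q_mulE x y : q_mul (quot_proj x) (quot_proj y) = quot_proj (x * y).
Proof.
apply/esym/quot_projP; rewrite invgM.
have sN := normal_set_subgroup N.
have Nx := repr_quot_proj x; have Ny := repr_quot_proj y.
have := subgroupM sN (normal_setJ y Nx) Ny.
by rewrite conjgE !mulgA mulgK.
Qed.

Lemma q_invE x : q_inv (quot_proj x) = quot_proj x^-1.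
Proof.
apply/quot_projP; rewrite invgK.
have := normal_setJ x^-1 (repr_quot_proj x).
by rewrite conjgE invgK -mulgA mulVKg.
Qed.

Lemma q_mulA : associative q_mul.
Proof.
move=> u v w; rewrite -(quot_repr u) -(quot_repr v) -(quot_repr w).
by rewrite !q_mulE mulgA.
Qed.

Lemma q_mul1 : left_id q_one q_mul.
Proof. by move=> u; rewrite -(quot_repr u) q_mulE mul1g. Qed.

Lemma q_mulr1 : right_id q_one q_mul.
Proof. by move=> u; rewrite -(quot_repr u) q_mulE mulg1. Qed.

Lemma q_mulV : left_inverse q_one q_inv q_mul.
Proof. by move=> u; rewrite -(quot_repr u) q_invE q_mulE mulVg. Qed.

Lemma q_mulrV : right_inverse q_one q_inv q_mul.
Proof. by move=> u; rewrite -(quot_repr u) q_invE q_mulE mulgV. Qed.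

HB.instance Definition _ := isGroup.Build quot
  q_mulA q_mul1 q_mulr1 q_mulV q_mulrV.

Lemma quot_projM x y : quot_proj (x * y) = quot_proj x * quot_proj y.
Proof. by rewrite -q_mulE. Qed.

Lemma quot_projV x : quot_proj x^-1 = (quot_proj x)^-1.
Proof. by rewrite -q_invE. Qed.

Lemma quot_proj1 : quot_proj 1 = 1.
Proof. by []. Qed.

(* The image of H in A / N is the subgroup H N / N. *)
Lemma quot_image_subgroup (H : set A) : subgroup H -> subgroup (quot_proj @` H).
Proof.
move=> sH; split; first by exists 1; [exact: subgroup1|].
move=> _ _ [x Hx <-] [y Hy <-]; exists (x / y); first exact: sH.2.
by rewrite quot_projM quot_projV.
Qed.

Definition quot_system (I : Type) (alpha : coset_system I A) :
    coset_system I quot :=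
  CosetSystem (fun i => quot_image_subgroup (parabolic_subgroup alpha i)).

Section InducedAction.
Variables (B : groupType) (eta : aut_action B A).
Hypothesis N_stable : forall b x, normal_set N x -> normal_set N (eta b x).

Definition quot_act (b : B) (u : quot) : quot := quot_proj (eta b (repr u)).

Lemma quot_actE b x : quot_act b (quot_proj x) = quot_proj (eta b x).
Proof.
apply/esym/quot_projP; rewrite -aut_actV -aut_act_mul.
exact/N_stable/repr_quot_proj.
Qed.

Lemma quot_act1 u : quot_act 1 u = u.
Proof. by rewrite -(quot_repr u) quot_actE aut_act1. Qed.

Lemma quot_actM b c u : quot_act (b * c) u = quot_act b (quot_act c u).
Proof. by rewrite -(quot_repr u) !quot_actE aut_actM. Qed.

Lemma quot_act_mul b u v :
  quot_act b (u * v) = quot_act b u * quot_act b v.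
Proof.
by rewrite -(quot_repr u) -(quot_repr v) -quot_projM !quot_actE aut_act_mul
  quot_projM.
Qed.

Definition quot_aut_action : aut_action B quot :=
  AutAction quot_act1 quot_actM quot_act_mul.

End InducedAction.

Lemma quot_par_actE (I : Type) (B : groupType) (alpha : coset_system I A)
    (eta : parabolic_action B alpha)
    (N_stable : forall b x, normal_set N x -> normal_set N (eta b x)) b i :
  quot_aut_action N_stable b @` quot_system alpha i
  = quot_system alpha (idx_act eta b i).
Proof.
apply/seteqP; split=> u /=.
  case=> _ [x ax <-] <-; exists (eta b x); last by rewrite quot_actE.
  by rewrite -par_actE; exists x.
rewrite -par_actE => -[_ [x ax <-] <-].
by exists (quot_proj x); [exists x|rewrite quot_actE].
Qed.

Definition quot_parabolic_action (I : Type) (B : groupType)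
    (alpha : coset_system I A) (eta : parabolic_action B alpha)
    (N_stable : forall b x, normal_set N x -> normal_set N (eta b x)) :
    parabolic_action B (quot_system alpha) :=
  ParabolicAction (idx_act1 eta) (idx_actM eta) (quot_par_actE N_stable).

End Quotient.

Arguments quot_parabolic_action {A N I B alpha} eta N_stable.

Definition normal_closure_set (A : groupType) (M : set A) : set A :=
  \bigcap_(N in [set N : normal_subgroup A | M `<=` N]) N.

Lemma normal_closure_subgroup (A : groupType) (M : set A) :
  subgroup (normal_closure_set M).
Proof. by apply: subgroup_bigcap => N _; exact: normal_set_subgroup. Qed.

Lemma normal_closureJ (A : groupType) (M : set A) x y :
  normal_closure_set M x -> normal_closure_set M (x ^ y).
Proof. by move=> Mx N MN; apply: normal_setJ; exact: Mx. Qed.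

Definition normal_closure (A : groupType) (M : set A) : normal_subgroup A :=
  NormalSubgroup (@normal_closure_subgroup A M) (@normal_closureJ A M).

Section NormalPreimage.
Variables (B A : groupType) (eta : aut_action B A) (N : normal_subgroup A).
Variable b : B.

Lemma preimJ x y : (eta b @^-1` N) x -> (eta b @^-1` N) (x ^ y).
Proof.
rewrite /preimage /= conjgE !aut_act_mul aut_actV -conjgE.
exact: normal_setJ.
Qed.

Definition preim_normal : normal_subgroup A :=
  NormalSubgroup
    (aut_act_preim_subgroup eta b (normal_set_subgroup N)) preimJ.

End NormalPreimage.

Lemma normal_closure_stable (B A : groupType) (eta : aut_action B A)
    (M : set A) :
  (forall b, eta b @` M = M) ->
  forall b x, normal_set (normal_closure M) x ->
  normal_set (normal_closure M) (eta b x).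
Proof.
move=> invM b x Mx N MN; apply: (Mx (preim_normal eta N b)) => m Mm /=.
by apply: MN; rewrite -(invM b); exists m.
Qed.

(* The letter (x, false) stands for the generator x, (x, true) for its
   inverse. *)
Definition word (X : Type) := seq (X * bool).

Definition winv (X : Type) (w : word X) : word X :=
  rev [seq (l.1, ~~ l.2) | l <- w].

Inductive wequiv (X : Type) (R : set (word X)) : word X -> word X -> Prop :=
| wequiv_refl w : wequiv R w w
| wequiv_sym v w : wequiv R v w -> wequiv R w v
| wequiv_trans u v w : wequiv R u v -> wequiv R v w -> wequiv R u w
| wequiv_cat u u' v v' :
    wequiv R u u' -> wequiv R v v' -> wequiv R (u ++ v) (u' ++ v')
| wequiv_cancel x e : wequiv R [:: (x, e); (x, ~~ e)] [::]
| wequiv_rel r : R r -> wequiv R r [::].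

Section Presented.
Variables (X : choiceType) (R : set (word X)).

Definition word_eq (v w : word X) : bool := `[< wequiv R v w >].

Lemma word_eq_refl : reflexive word_eq.
Proof. by move=> w; apply/asboolP; exact: wequiv_refl. Qed.

Lemma word_eq_sym : symmetric word_eq.
Proof.
by move=> v w; apply/idP/idP => /asboolP h; apply/asboolP; exact: wequiv_sym.
Qed.

Lemma word_eq_trans : transitive word_eq.
Proof.
by move=> v u w /asboolP uv /asboolP vw; apply/asboolP; exact: wequiv_trans vw.
Qed.

Canonical word_equiv := EquivRel word_eq word_eq_refl word_eq_sym word_eq_trans.

Definition presented := {eq_quot word_equiv}.

HB.instance Definition _ := Choice.on presented.
HB.instance Definition _ := EqQuotient.on presented.

Definition word_class (w : word X) : presented := \pi w.

Lemma word_classP v w : word_class v = word_class w <-> wequiv R v w.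
Proof.
split=> [/eqmodP /asboolP //|h]; apply/eqmodP.
exact/asboolP.
Qed.

Lemma word_repr u : word_class (repr u) = u.
Proof. exact: reprK. Qed.

Lemma repr_word_class w : wequiv R w (repr (word_class w)).
Proof. by apply/word_classP; rewrite word_repr. Qed.

Lemma wequiv_winvr w : wequiv R (w ++ winv w) [::].
Proof.
elim: w => [|[x e] w IH]; first exact: wequiv_refl.
have -> : ((x, e) :: w) ++ winv ((x, e) :: w)
    = [:: (x, e)] ++ (w ++ winv w) ++ [:: (x, ~~ e)].
  by rewrite /winv /= rev_cons -cats1 catA.
apply: wequiv_trans (wequiv_cancel R x e).
rewrite -[X in wequiv _ _ X]/([:: (x, e)] ++ [::] ++ [:: (x, ~~ e)]).
apply: wequiv_cat; first exact: wequiv_refl.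
by apply: wequiv_cat; [exact: IH|exact: wequiv_refl].
Qed.

Lemma winvK (w : word X) : winv (winv w) = w.
Proof.
rewrite /winv map_rev revK -map_comp map_id_in // => -[x e] _ /=.
by rewrite negbK.
Qed.

Lemma wequiv_winvl w : wequiv R (winv w ++ w) [::].
Proof. by rewrite -[X in _ ++ X]winvK; exact: wequiv_winvr. Qed.

Definition p_one : presented := word_class [::].
Definition p_mul (u v : presented) : presented := word_class (repr u ++ repr v).
Definition p_inv (u : presented) : presented := word_class (winv (repr u)).

Lemma p_mulE v w : p_mul (word_class v) (word_class w) = word_class (v ++ w).
Proof.
apply/word_classP; apply: wequiv_cat; apply: wequiv_sym;
  exact: repr_word_class.
Qed.

Lemma p_mulA : associative p_mul.
Proof.
move=> u v w; rewrite -(word_repr u) -(word_repr v) -(word_repr w).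
by rewrite !p_mulE catA.
Qed.

Lemma p_mul1 : left_id p_one p_mul.
Proof. by move=> u; rewrite -(word_repr u) p_mulE. Qed.

Lemma p_mulr1 : right_id p_one p_mul.
Proof. by move=> u; rewrite -(word_repr u) p_mulE cats0. Qed.

Lemma p_mulV : left_inverse p_one p_inv p_mul.
Proof.
move=> u; rewrite /p_inv -[X in p_mul _ X](word_repr u) p_mulE.
exact/word_classP/wequiv_winvl.
Qed.

Lemma p_mulrV : right_inverse p_one p_inv p_mul.
Proof.
move=> u; rewrite /p_inv -[X in p_mul X _](word_repr u) p_mulE.
exact/word_classP/wequiv_winvr.
Qed.

HB.instance Definition _ := isGroup.Build presented
  p_mulA p_mul1 p_mulr1 p_mulV p_mulrV.

Lemma word_class_cat v w : word_class (v ++ w) = word_class v * word_class w.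
Proof. by rewrite -p_mulE. Qed.

Lemma word_class_nil : word_class [::] = 1.
Proof. by []. Qed.

Definition presented_gen (x : X) : presented := word_class [:: (x, false)].

Section RelabelingAction.
Variables (B : groupType) (act : B -> X -> X).
Hypothesis act_1 : forall x, act 1 x = x.
Hypothesis act_M : forall b c x, act (b * c) x = act b (act c x).

Definition word_act (b : B) (w : word X) : word X :=
  [seq (act b l.1, l.2) | l <- w].

Hypothesis act_rel : forall b r, R r -> R (word_act b r).

Definition presented_act (b : B) (u : presented) : presented :=
  word_class (word_act b (repr u)).

Lemma wequiv_act b v w : wequiv R v w -> wequiv R (word_act b v) (word_act b w).
Proof.
elim=> {v w}.
- by move=> w; exact: wequiv_refl.
- by move=> v w _; exact: wequiv_sym.
- by move=> u v w _ h _; exact: wequiv_trans.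
- by move=> u u' v v' _ h _ h'; rewrite /word_act !map_cat; exact: wequiv_cat.
- by move=> x e; exact: wequiv_cancel.
- by move=> r Rr; apply/wequiv_rel/act_rel.
Qed.

Lemma presented_actE b w :
  presented_act b (word_class w) = word_class (word_act b w).
Proof. by apply/word_classP/wequiv_act/wequiv_sym/repr_word_class. Qed.

Lemma presented_act1 u : presented_act 1 u = u.
Proof.
rewrite -(word_repr u) presented_actE; congr word_class.
by rewrite /word_act map_id_in // => -[x e] _ /=; rewrite act_1.
Qed.

Lemma presented_actM b c u :
  presented_act (b * c) u = presented_act b (presented_act c u).
Proof.
rewrite -(word_repr u) !presented_actE; congr word_class.
rewrite /word_act -map_comp; apply: eq_map => -[x e] /=.
by rewrite act_M.
Qed.

Lemma presented_act_mul b u v :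
  presented_act b (u * v) = presented_act b u * presented_act b v.
Proof.
rewrite -(word_repr u) -(word_repr v) -word_class_cat !presented_actE.
by rewrite -word_class_cat /word_act map_cat.
Qed.

Definition presented_aut_action : aut_action B presented :=
  AutAction presented_act1 presented_actM presented_act_mul.

Lemma presented_act_gen b x :
  presented_aut_action b (presented_gen x) = presented_gen (act b x).
Proof. by rewrite /= presented_actE. Qed.

End RelabelingAction.
End Presented.

Section Diagonal.
Variables (I : Type) (B : groupType) (beta : coset_system I B) (j : I).

Definition facets : Type := lcosets (beta j).
HB.instance Definition _ := Choice.on facets.

Lemma facet_actP b (F : facets) : lcoset b (val F) \in lcosets (beta j).
Proof.
case: F => F /= /set_mem [x _ <-]; apply/mem_set.
by exists (b * x); rewrite ?lcosetA.
Qed.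

Definition facet_act (b : B) (F : facets) : facets := SigSub (facet_actP b F).

Lemma facet_act1 F : facet_act 1 F = F.
Proof. by apply: val_inj; rewrite /= lcoset1. Qed.

Lemma facet_actM b c F : facet_act (b * c) F = facet_act b (facet_act c F).
Proof. by apply: val_inj; rewrite /= lcosetA. Qed.

Lemma base_facetP : beta j \in lcosets (beta j).
Proof. by apply/mem_set; exists 1; rewrite ?lcoset1. Qed.

Definition base_facet : facets := SigSub base_facetP.

Lemma base_facet_orbit (L : orbits facet_act) : val L base_facet.
Proof.
case: L => L /= /set_mem [[F FP] _ <-].
case: (set_mem FP) => x _ xF; exists x^-1 => //.
by apply: val_inj; rewrite /= -xF lcosetA mulVg lcoset1.
Qed.

Definition base_reps : orbit_reps facet_act := OrbitReps base_facet_orbit.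

(* Unordered pairs of distinct cosets are encoded as two-element sets. *)
Definition diagonals : set (set facets) :=
  [set D | exists F E, F <> E /\ D = [set F; E]].

Definition diagonal_class (D : set facets) : set (set facets) :=
  [set facet_act b @` D | b in setT].

Definition diagonal_classes : set (set (set facets)) :=
  diagonal_class @` diagonals.

Lemma facet_pair_classP (F E : facets) (FE : F <> E) :
  diagonal_class [set F; E] \in diagonal_classes.
Proof. by apply/mem_set; exists [set F; E] => //; exists F, E. Qed.

Definition facet_pair_class (F E : facets) (FE : F <> E) : diagonal_classes :=
  SigSub (facet_pair_classP FE).

(* None stands for the label infinity. *)
Record diagonal_labelling := DiagonalLabelling {
  label :> diagonal_classes -> option nat;
  label_ge2 : forall c n, label c = Some n -> 2 <= n }.

Variable lambda : diagonal_labelling.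

(* The Coxeter graph is recorded through the label of every pair of distinct
   vertices: Some 2 means that the two vertices are not joined. *)
Definition coxeter_relators : set (word facets) :=
  [set r | (exists F, r = [:: (F, false); (F, false)])
        \/ (exists F E (FE : F <> E) n,
              lambda (facet_pair_class FE) = Some n
              /\ r = flatten (nseq n [:: (F, false); (E, false)]))].

Definition coxeter_group := presented coxeter_relators.
HB.instance Definition _ := Group.on coxeter_group.

Definition coxeter_gen (F : facets) : coxeter_group :=
  presented_gen coxeter_relators F.

Definition coxeter_system : coset_system facets coxeter_group :=
  CosetSystem (fun F =>
    generated_subgroup [set coxeter_gen E | E in ~` [set F]]).

Lemma facet_act_inj b : injective (facet_act b).
Proof.
move=> F E e.
by rewrite -(facet_act1 F) -(facet_act1 E) -(mulVg b) !facet_actM e.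
Qed.

Lemma facet_pair_class_act b F E (FE : F <> E)
    (bFE : facet_act b F <> facet_act b E) :
  facet_pair_class bFE = facet_pair_class FE.
Proof.
apply: val_inj => /=.
have -> : [set facet_act b F; facet_act b E] = facet_act b @` [set F; E].
  apply/seteqP; split=> x /=.
    by case=> ->; [exists F; [left|]|exists E; [right|]].
  by case=> y [] -> <-; [left|right].
have comp c (D : set facets) :
    facet_act c @` (facet_act b @` D) = facet_act (c * b) @` D.
  apply/seteqP; split=> x /=.
    by case=> _ [y Dy <-] <-; exists y; rewrite ?facet_actM.
  by case=> y Dy <-; exists (facet_act b y); [exists y|rewrite facet_actM].
apply/seteqP; split=> D /= [c _ <-].
  by exists (c * b); rewrite ?comp.
by exists (c / b); rewrite ?comp ?mulgVK.
Qed.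

Lemma coxeter_relators_act b r :
  coxeter_relators r -> coxeter_relators (word_act facet_act b r).
Proof.
case=> [[F ->]|[F [E [FE [n [FEn ->]]]]]]; [left|right].
  by exists (facet_act b F).
have bFE : facet_act b F <> facet_act b E by move/facet_act_inj.
exists (facet_act b F), (facet_act b E), bFE, n.
rewrite (facet_pair_class_act FE bFE); split=> //.
by rewrite /word_act map_flatten map_nseq.
Qed.

Definition coxeter_aut_action : aut_action B coxeter_group :=
  presented_aut_action facet_act1 facet_actM coxeter_relators_act.

Lemma coxeter_act_gen b F :
  coxeter_aut_action b (coxeter_gen F) = coxeter_gen (facet_act b F).
Proof. exact: presented_act_gen. Qed.

Lemma coxeter_par_actE b F :
  coxeter_aut_action b @` coxeter_system F = coxeter_system (facet_act b F).
Proof.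
have sub c E x : coxeter_system E x ->
    coxeter_system (facet_act c E) (coxeter_aut_action c x).
  move=> Ex H [sH gH]; apply: (Ex (coxeter_aut_action c @^-1` H)); split.
    exact: aut_act_preim_subgroup.
  move=> _ [D nDE <-]; suff: H (coxeter_aut_action c (coxeter_gen D)) by [].
  rewrite coxeter_act_gen; apply: gH.
  by exists (facet_act c D) => // /facet_act_inj.
apply/seteqP; split=> x; first by case=> y Fy <-; exact: sub.
move=> /(sub b^-1); rewrite -facet_actM mulVg facet_act1 => h.
by exists (coxeter_aut_action b^-1 x); rewrite ?aut_actKV.
Qed.

Definition coxeter_action : parabolic_action B coxeter_system :=
  ParabolicAction facet_act1 facet_actM coxeter_par_actE.

End Diagonal.

(* Main.v *)
Require Import Defs.
From Stdlib Require Import Relation_Operators.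
From mathcomp Require Import all_boot.
From mathcomp Require Import ssralg ssrnum poly algC cyclotomic.
From mathcomp Require Import ring.
From mathcomp Require Import boolp classical_sets cardinality.

(** The proof rests on a description of regular hypertopes inside the group.
    For a coset system $(G, (G_i))$ flag-transitivity is a Helly property:
    pairwise intersecting cosets of the $G_i$ have a common point.  Granted
    this, every flag is a translate of a standard one, and the remaining axioms
    become statements about $G_J = \bigcap_{i\in J} G_i$: thinness says that
    $G_{I\setminus i}\cap G_i$ has index two in $G_{I\setminus i}$, residual
    connectedness that $G_J$ is generated by the $G_{J\cup k}$, $k\notin J$,
    whenever two types are missing from $J$, and faithfulness that the $G_i$
    contain no common nontrivial normal subgroup
    (theorem regular_hypertopeP).

    In this form the twisting is a direct computation in $A\rtimes B$ (theorem
    twisting_regular_hypertope).  A coset of $G_i$ is the product of a coset of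
    $B_i$ in $B$ with a coset in $A$ of some $A_J$, where $J$ depends on the
    coset of $B_i$, and the latter is the intersection of the cosets of the
    $A_k$, $k\in J$; so the Helly property of the twisting follows from that of
    $\beta$ and then that of $\alpha$.  Each of the two index-two conditions is
    inherited from one factor.  For residual connectedness one uses that, the
    index set of $\alpha$ being finite, $A_J$ is generated by its minimal
    parabolics, each of which is conjugate under $B$ to the one at the chosen
    representative of its orbit.  Admissibility is needed for arbitrary, not
    only binary, intersections, and for the orbit of $B_j$ in $X_j$ this is
    again the Helly property of $\beta$.

    Part (b) is an instance, since the quotient system is assumed to be a
    regular hypertope.  Part (a) needs that the standard system of a Coxeter
    group of finite rank is one.  The exchange condition comes from Tits'
    action of the group on signed elements.  It shows that reduced words of
    elements of a special subgroup use only its letters and that a coset of a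
    special subgroup has a gate, through which there is a shortest path from
    the identity to each of its elements; projecting to gates one coset at a
    time gives the Helly property (lemmas special_reduced, special_gate and
    coxeter_helly).  That distinct letters are distinct elements requires a
    representation: the geometric one, realised over the algebraic numbers. *)

Set Implicit Arguments.
Unset Strict Implicit.
Unset Printing Implicit Defensive.

Local Open Scope classical_set_scope.
Local Open Scope group_scope.

(** * Regular hypertopes in terms of subgroups *)

Section Cosets.
Variable G : groupType.
Implicit Types (H S : set G) (x y z : G).

Lemma lcosetP H x z : lcoset x H z <-> H (x^-1 * z).
Proof.
split=> [[h Hh <-]|Hxz]; first by rewrite mulKg.
by exists (x^-1 * z); rewrite ?mulVKg.
Qed.

Lemma eq_lcoset H x y : subgroup H -> lcoset x H = lcoset y H <-> H (x^-1 * y).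
Proof.
move=> sH; split=> [e|Hxy].
  by apply/lcosetP; rewrite e; apply/lcosetP; rewrite mulVg; exact: subgroup1.
apply/seteqP; split=> z /lcosetP h; apply/lcosetP.
  rewrite -(mulVKg x z) mulgA -[y^-1 * x]invgK invgM invgK.
  by apply: subgroupM => //; exact: subgroupV.
by rewrite -(mulVKg y z) mulgA; apply: subgroupM.
Qed.

Lemma sub_generated S : S `<=` generated S.
Proof. by move=> x Sx H [_]; apply. Qed.

Lemma generated_sub S H : subgroup H -> S `<=` H -> generated S `<=` H.
Proof. by move=> sH SH x; apply. Qed.

End Cosets.

Section Criterion.
Variables (I : Type) (G : groupType) (P : coset_system I G).
Implicit Types (i k : I) (J : set I) (x y z g : G).

Lemma parabolics_subgroup J : subgroup (parabolics P J).
Proof. by apply: subgroup_bigcap => i _; exact: parabolic_subgroup. Qed.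

(** A family of cosets is given by the relation R i x holding when the coset
    of P i through x is a member; allowing several x for each i avoids choosing
    representatives. *)
Definition coherent (R : I -> set G) : Prop :=
  forall i k x y, R i x -> R k y -> exists z, P i (x^-1 * z) /\ P k (y^-1 * z).

Definition helly : Prop :=
  forall R, coherent R -> exists g, forall i x, R i x -> P i (x^-1 * g).

(** Index two: the cosets of 1 and s are the only ones, and are distinct. *)
Definition thin_parabolics : Prop :=
  forall i, exists s, [/\ parabolics P (~` [set i]) s, ~ P i s
    & forall x, parabolics P (~` [set i]) x -> P i x \/ P i (s^-1 * x)].

Definition residually_generated : Prop :=
  forall J, (exists i k, [/\ i <> k, ~ J i & ~ J k]) ->
  parabolics P J `<=`
    generated (\bigcup_(k in ~` J) parabolics P (J `|` [set k])).

Definition core_free : Prop :=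
  forall g, (forall i x, P i (x^-1 * g * x)) -> g = 1.


Definition coset_flag g J : set (I * set G) := [set (i, lcoset g (P i)) | i in J].

Let sP i : subgroup (P i) := parabolic_subgroup P i.

Lemma parabolicVV i x : P i (x^-1 * x).
Proof. by rewrite mulVg; exact: subgroup1. Qed.

Lemma parabolic_trans i x y z : P i (x^-1 * z) -> P i (y^-1 * z) -> P i (x^-1 * y).
Proof.
move=> xz yz; rewrite -[y](mulVKg z) mulgA; apply: subgroupM => //.
by rewrite -[z^-1 * y]invgK invgM invgK; exact: subgroupV.
Qed.

Lemma coset_element i x : element P (i, lcoset x (P i)).
Proof. by exists x. Qed.

Lemma incident_cosets i k x y :
  incident (i, lcoset x (P i)) (k, lcoset y (P k)) <->
  exists z, P i (x^-1 * z) /\ P k (y^-1 * z).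
Proof. by split=> -[z [] /= /lcosetP h /lcosetP h']; exists z. Qed.

Lemma coset_flag_flag g J : flag P (coset_flag g J).
Proof.
split=> [_ [i _ <-]|_ _ [i _ <-] [k _ <-]]; first exact: coset_element.
by apply/incident_cosets; exists g; split; exact: parabolicVV.
Qed.

Lemma coset_flag_type g J : flag_type (coset_flag g J) = J.
Proof.
apply/seteqP; split=> [i [_ [k Jk <-] <-] //|i Ji].
by exists (i, lcoset g (P i)) => //; exists i.
Qed.

Lemma translate_coset_flag h g J :
  translate h @` coset_flag g J = coset_flag (h * g) J.
Proof.
apply/seteqP; split=> [_ [_ [i Ji <-] <-]|_ [i Ji <-]].
  by exists i => //; rewrite /translate /= lcosetA.
exists (i, lcoset g (P i)); first by exists i.
by rewrite /translate /= lcosetA.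
Qed.

(** The elements of a flag are pairwise intersecting cosets, so by the Helly
    property they all pass through one point g. *)
Lemma flag_coset_flag (F : set (I * set G)) : helly -> flag P F ->
  exists g, F = coset_flag g (flag_type F).
Proof.
move=> hP [elF incF].
have [i k x y Fx Fy|g gP] := hP (fun i x => F (i, lcoset x (P i))).
  by apply/incident_cosets; exact: incF.
have Fg i Q : F (i, Q) -> Q = lcoset g (P i).
  move=> FQ; case: (elF _ FQ) => x _ /= xQ; rewrite -xQ.
  by apply/eq_lcoset => //; apply: gP; rewrite xQ.
exists g; apply/seteqP; split=> [[i Q] FQ|].
  by exists i; [exists (i, Q)|rewrite (Fg _ _ FQ)].
by move=> _ [i [[k Q] FQ /= <-] <-]; rewrite -(Fg _ _ FQ).
Qed.

(** A pairwise intersecting family of cosets is a flag, so the group element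
    carrying the standard flag of the same type onto it is a common point;
    conversely any two flags are translates of a standard flag. *)
Lemma flag_transitiveP : flag_transitive P <-> helly.
Proof.
split=> [ftP R cR|hP F F' flF flF' eFF'].
  pose F := [set p | exists i x, R i x /\ p = (i, lcoset x (P i))].
  have flF : flag P F.
    split=> [_ [i [x [_ ->]]]|_ _ [i [x [Rx ->]]] [k [y [Ry ->]]]].
      exact: coset_element.
    by apply/incident_cosets; exact: cR.
  have [|g gF] := ftP _ _ (coset_flag_flag 1 (flag_type F)) flF.
    exact: coset_flag_type.
  exists g => i x Rx.
  have : F (i, lcoset x (P i)) by exists i, x.
  rewrite -gF translate_coset_flag mulg1 => -[k _ [<-]] /esym.
  by move/(eq_lcoset _ _ (sP k)).
have [g ->] := flag_coset_flag hP flF; have [g' ->] := flag_coset_flag hP flF'.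
by exists (g' * g^-1); rewrite eFF' translate_coset_flag mulgVK.
Qed.

Lemma helly_chamber : helly -> incidence_geometry P.
Proof.
move=> hP F flF maxF; split=> //; have [g Fg] := flag_coset_flag hP flF.
rewrite -(maxF (coset_flag g setT)) ?coset_flag_type //.
  exact: coset_flag_flag.
by rewrite Fg => _ [i _ <-]; exists i.
Qed.

(** The subgroup $P_J$ is itself the intersection of cosets through 1, so the
    Helly property applies to two cosets and $P_J$ together. *)
Lemma helly_parabolics J i k x y : helly ->
  parabolics P J x -> parabolics P J y ->
  (exists z, P i (x^-1 * z) /\ P k (y^-1 * z)) ->
  exists z, [/\ parabolics P J z, P i (x^-1 * z) & P k (y^-1 * z)].
Proof.
move=> hP Jx Jy [z0 [xz yz]].
pose R l u := [\/ J l /\ u = 1, l = i /\ u = x | l = k /\ u = y].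
have inJ l u : J l -> parabolics P J u -> P l (1^-1 * u).
  by rewrite invg1 mul1g => Jl; apply.
have [|z zP] := hP R.
  move=> l m u v [[Jl ->]|[-> ->]|[-> ->]] [[Jm ->]|[-> ->]|[-> ->]].
  - by exists 1; split; exact: parabolicVV.
  - by exists x; split; [exact: inJ|exact: parabolicVV].
  - by exists y; split; [exact: inJ|exact: parabolicVV].
  - by exists x; split; [exact: parabolicVV|exact: inJ].
  - by exists x; split; exact: parabolicVV.
  - by exists z0.
  - by exists y; split; [exact: parabolicVV|exact: inJ].
  - by exists z0.
  - by exists y; split; exact: parabolicVV.
exists z; split.
- by move=> l Jl; have := zP l 1; rewrite invg1 mul1g; apply; constructor 1.
- by apply: zP; constructor 2.
- by apply: zP; constructor 3.
Qed.

(** The residue of the standard flag of type J is the coset system of $P_J$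
    with the subgroups $P_{J\cup i}$: a coset of P i that meets P k for every k
    in J meets $P_J$. *)
Lemma residue_coset_flag J g : helly ->
  residue P (coset_flag g J)
  = [set p | exists i x, [/\ ~ J i, parabolics P J x
      & p = (i, lcoset (g * x) (P i))]].
Proof.
move=> hP; apply/seteqP; split=> p.
  case: p => i Q [[y _ /= <-] nF inc].
  have inc' k : J k -> exists z, P i (y^-1 * z) /\ P k (g^-1 * z).
    by move=> Jk; apply/incident_cosets; apply: inc; exists k.
  have nJi : ~ J i.
    move=> Ji; apply: nF; exists i => //; congr pair; apply/eq_lcoset => //.
    by have [z [h h']] := inc' i Ji; exact: parabolic_trans h.
  have [|c cP] := hP (fun k x => J k /\ x = g \/ k = i /\ x = y).
    move=> k l x x' [[Jk ->]|[-> ->]] [[Jl ->]|[-> ->]].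
    + by exists g; split; exact: parabolicVV.
    + by have [z []] := inc' k Jk; exists z.
    + exact: inc'.
    + by exists y; split; exact: parabolicVV.
  exists i, (g^-1 * c); split=> //; first by move=> k Jk; apply: cP; left.
  by congr pair; rewrite mulVKg; apply/eq_lcoset => //; apply: cP; right.
case=> i [x [nJi Jx ->]]; split; first exact: coset_element.
  by case=> k Jk [ki _]; apply: nJi; rewrite -ki.
move=> _ [k Jk <-]; apply/incident_cosets; exists (g * x).
by rewrite mulKg; split; [exact: parabolicVV|exact: Jx].
Qed.

(** Up to translation a flag of corank one is the standard flag of type
    $I\setminus i$, and its residue consists of the cosets of
    $P_{I\setminus i}\cap P_i$ in $P_{I\setminus i}$. *)
Lemma thinP : helly -> thin P <-> thin_parabolics.
Proof.
move=> hP; split=> [tP i|tP F flF [i Fi]].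
  have sPi := parabolics_subgroup (~` [set i]).
  have [|p [q [pq]]] := tP _ (coset_flag_flag 1 (~` [set i])).
    by exists i; rewrite coset_flag_type setCK.
  rewrite residue_coset_flag // => E.
  have inE x : parabolics P (~` [set i]) x ->
      [set p; q] (i, lcoset x (P i)).
    by move=> Px; rewrite -E; exists i, x; split=> //; [apply|rewrite mul1g].
  have Eq r : [set p; q] r -> exists x, parabolics P (~` [set i]) x
      /\ r = (i, lcoset x (P i)).
    rewrite -E => -[k [x [nk Px ->]]]; exists x; split=> //.
    by rewrite mul1g (contrapT nk).
  (* The element of the residue other than P i is the coset of s. *)
  have [s [Ps nPs Es]] : exists s, [/\ parabolics P (~` [set i]) s, ~ P i s
      & [set p; q] = [set (i, lcoset 1 (P i)); (i, lcoset s (P i))]].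
    have [x [Px xp]] := Eq p (or_introl erefl).
    have [y [Py yq]] := Eq q (or_intror erefl).
    have coset1 z : P i z -> (i, lcoset 1 (P i)) = (i, lcoset z (P i)).
      by move=> iz; congr pair; apply/eq_lcoset => //; rewrite invg1 mul1g.
    case: (inE _ (subgroup1 sPi)) => [one_p|one_q].
      exists y; split=> //; last by rewrite one_p yq.
      by move/coset1; rewrite one_p -yq.
    exists x; split=> //; last by rewrite one_q xp setUC.
    by move/coset1; rewrite one_q -xp => /esym.
  exists s; split=> // x /inE; rewrite Es => -[] [] /esym.
    by move/(eq_lcoset _ _ (sP i)); rewrite invg1 mul1g; left.
  by move/(eq_lcoset _ _ (sP i)); right.
have [g Fg] := flag_coset_flag hP flF.
have [s [Ps nPs sPs]] := tP i.
have FiC : flag_type F = ~` [set i] by rewrite -Fi setCK.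
rewrite Fg FiC residue_coset_flag //.
exists (i, lcoset g (P i)), (i, lcoset (g * s) (P i)); split.
  by case=> /(eq_lcoset _ _ (sP i)); rewrite mulKg.
apply/seteqP; split=> p.
  case=> k [x [/contrapT -> Px ->]].
  have [ix|isx] := sPs x Px; [left|right]; congr pair; apply/esym.
    by apply/eq_lcoset => //; rewrite mulKg.
  by apply/eq_lcoset => //; rewrite invgM -mulgA mulKg.
case=> ->.
  exists i, 1; rewrite mulg1; split=> //; first by apply.
  by apply: subgroup1; exact: parabolics_subgroup.
by exists i, s; split=> //; apply.
Qed.

Lemma faithfulP : faithful P <-> core_free.
Proof.
have mvP g i x : translate g (i, lcoset x (P i)) = (i, lcoset x (P i)) <->
    P i (x^-1 * g * x).
  rewrite /translate /= lcosetA; split=> [[/esym]|ix].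
    by move/(eq_lcoset _ _ (sP i)); rewrite mulgA.
  by congr pair; apply/esym/eq_lcoset => //; rewrite mulgA.
split=> fP g gP; apply: fP.
  by move=> [i Q] [x _ /= <-]; exact/mvP.
by move=> i x; apply/mvP/gP; exact: coset_element.
Qed.

(** Two incident cosets in the residue of the standard flag of type J share a
    point of $P_J$, and any two points of $P_J$ in one of them differ by an
    element of some $P_{J\cup l}$.  So walking along a path from the coset of 1
    to the coset of x never leaves the subgroup generated by the
    $P_{J\cup l}$. *)
Lemma residually_connected_generated : helly ->
  residually_connected P -> residually_generated.
Proof.
move=> hP cP J [i [k [ik nJi nJk]]] x Jx.
set H := generated _; have sH : subgroup H := generated_subgroup _.
have HI l y z : ~ J l -> parabolics P J y -> parabolics P J z ->
    P l (y^-1 * z) -> H (y^-1 * z).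
  move=> nJl Jy Jz lyz; apply: sub_generated; exists l => // m [Jm|-> //].
  by apply: subgroupM (Jz _ Jm) => //; apply: subgroupV => //; exact: Jy.
have resE := residue_coset_flag J 1 hP.
pose good p := exists y, [/\ parabolics P J y, H y & p = (p.1, lcoset y (P p.1))].
have step p q : residue P (coset_flag 1 J) p -> residue P (coset_flag 1 J) q ->
    incident p q -> good p -> good q.
  rewrite resE => -[l [u [nJl Ju ->]]] [m [v [nJm Jv ->]]].
  rewrite !mul1g => inc [y [Jy Hy /= [eu]]].
  move: inc; rewrite eu => /incident_cosets /(helly_parabolics hP Jy Jv).
  case=> z [Jz yz vz]; exists z; split=> //.
    by rewrite -(mulVKg y z); apply: (subgroupM sH Hy); exact: HI yz.
  by congr pair; apply/eq_lcoset.
have path p q : clos_refl_trans _ (fun x y : I * set G =>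
    [/\ residue P (coset_flag 1 J) x, residue P (coset_flag 1 J) y
      & incident x y]) p q -> good p -> good q.
  elim=> {p q} [p q [Rp Rq pq]|//|p q r _ IH1 _ IH2 gp]; first exact: step pq.
  by apply/IH2/IH1.
have [||z [Jz Hz [e]]] := path (i, lcoset 1 (P i)) (i, lcoset x (P i)).
- apply: cP; first exact: coset_flag_flag.
  + by rewrite coset_flag_type; exists i, k.
  + rewrite resE; exists i, 1; rewrite mul1g; split=> //.
    by apply: subgroup1; exact: parabolics_subgroup.
  + by rewrite resE; exists i, x; rewrite mul1g.
- exists 1; split=> //; last exact: subgroup1.
  by apply: subgroup1; exact: parabolics_subgroup.
move/(eq_lcoset _ _ (sP i)): e => xz.
have := HI i x z nJi Jx Jz xz => /(subgroupV sH); rewrite invgM invgK => zx.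
by rewrite -(mulVKg z x); exact: (subgroupM sH).
Qed.

(** Multiplying u on the right by an element of $P_{J\cup k}$ does not change
    the coset of P k through u, which is incident with all the cosets through
    u; hence generators of this kind lead from any element of the residue to
    any other. *)
Lemma residually_generated_connected : helly ->
  residually_generated -> residually_connected P.
Proof.
move=> hP gP F flF [i0 [k0 [ik nFi nFk]]].
have [g Fg] := flag_coset_flag hP flF; set J := flag_type F in nFi nFk Fg.
have resE := residue_coset_flag J g hP; rewrite Fg /connected_incidence.
set adj := (fun x y : I * set G => [/\ _, _ & _]).
(* Any two types of elements at the same point are incident there. *)
have same l m u : ~ J l -> ~ J m -> parabolics P J u ->
    adj (l, lcoset (g * u) (P l)) (m, lcoset (g * u) (P m)).
  move=> nJl nJm Ju; rewrite /adj resE; split; [by exists l, u|by exists m, u|].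
  by apply/incident_cosets; exists (g * u); split; exact: parabolicVV.
pose H := [set x | parabolics P J x /\ forall u l m, parabolics P J u ->
  ~ J l -> ~ J m -> clos_refl_trans _ adj
    (l, lcoset (g * u) (P l)) (m, lcoset (g * (u * x)) (P m))].
have sJ := parabolics_subgroup J.
have symadj p q : clos_refl_trans _ adj p q -> clos_refl_trans _ adj q p.
  elim=> {p q} [p q [Rp Rq [z [zp zq]]]|p|p q r _ IH1 _ IH2].
  + by apply: rt_step; split=> //; exists z.
  + exact: rt_refl.
  + exact: rt_trans IH2 IH1.
have sH : subgroup H.
  split=> [|x y [Jx Hx] [Jy Hy]].
    split=> [|u l m Ju nJl nJm]; first exact: subgroup1.
    by rewrite mulg1; apply: rt_step; exact: same.
  split=> [|u l m Ju nJl nJm]; first exact: sJ.2.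
  apply: (rt_trans _ _ _ (m, lcoset (g * (u * x)) (P m))); first exact: Hx.
  apply: symadj.
  have -> : u * x = u * (x / y) * y by rewrite -mulgA mulgVK.
  apply: Hy => //; apply: (subgroupM sJ) => //; exact: sJ.2.
have HJ : parabolics P J `<=` H.
  apply: subset_trans (gP J _) _; first by exists i0, k0.
  apply: generated_sub => // x [k nJk Jkx].
  have Jx : parabolics P J x by move=> l Jl; apply: Jkx; left.
  split=> // u l m Ju nJl nJm.
  have Jux := subgroupM sJ Ju Jx.
  apply: (rt_trans _ _ _ (k, lcoset (g * u) (P k))).
    by apply: rt_step; exact: same.
  have -> : lcoset (g * u) (P k) = lcoset (g * (u * x)) (P k).
    apply/eq_lcoset => //; rewrite [g * (u * x)]mulgA mulKg.
    by apply: Jkx; right.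
  by apply: rt_step; exact: same.
move=> p q; rewrite resE => -[l [x [nJl Jx ->]]] [m [y [nJm Jy ->]]].
have [_] := HJ _ (subgroupM sJ (subgroupV sJ Jx) Jy).
by move/(_ x l m Jx nJl nJm); rewrite mulVKg.
Qed.

Theorem regular_hypertopeP : regular_hypertope P <->
  [/\ helly, thin_parabolics, residually_generated & core_free].
Proof.
split=> [[_ tP cP fP /flag_transitiveP hP]|[hP tP gP fP]].
  split=> //; [exact/thinP|exact: residually_connected_generated|exact/faithfulP].
split; [exact: helly_chamber|exact/thinP|exact: residually_generated_connected
  |exact/faithfulP|exact/flag_transitiveP].
Qed.

End Criterion.

(** * Twistings of regular hypertopes *)

(** The generators found in $P_J$ when the index set is finite: a missing type
    k contributes the parabolic that fixes all the other types, and the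
    intersection of all the P i takes care of the case without missing
    types. *)
Definition minimal_parabolics (I : Type) (G : groupType) (P : coset_system I G)
    (J : set I) : set G :=
  parabolics P setT `|` \bigcup_(k in ~` J) parabolics P (~` [set k]).

Lemma parabolicsS (I : Type) (G : groupType) (P : coset_system I G)
  (J K : set I) : J `<=` K -> parabolics P K `<=` parabolics P J.
Proof. by move=> JK x Kx i /JK; exact: Kx. Qed.

(** Repeated use of residual generation adds types to J until at most one is
    missing; finiteness of the index set makes this stop. *)
Lemma generated_minimal_parabolics (I : choiceType) (G : groupType)
    (P : coset_system I G) : residually_generated P -> finite_set [set: I] ->
  forall J, parabolics P J `<=` generated (minimal_parabolics P J).
Proof.
move=> gP /finite_seqP [s Is] J.
have : forall k, ~ J k -> k \in s.
  by move=> k _; suff : [set` s] k by []; rewrite -Is.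
move: {2}(size s) (leqnn (size s)) => n; elim: n s J {Is} => [|n IH] s J.
  rewrite leqn0 => /nilP -> Js; apply: subset_trans (@sub_generated _ _).
  apply: (subset_trans _ (@subsetUl _ _ _)); apply: parabolicsS => k _.
  by apply: contrapT => /Js.
move=> sn Js.
have [Jmiss|] := pselect (exists i k, [/\ i <> k, ~ J i & ~ J k]).
  apply: subset_trans (gP J Jmiss) _.
  apply: generated_sub; first exact: generated_subgroup.
  move=> x [k nJk Jkx].
  have : generated (minimal_parabolics P (J `|` [set k])) x.
    apply: (IH [seq l <- s | l != k]) => // [|l nJkl].
      rewrite -ltnS (leq_trans _ sn) // size_filter.
      rewrite -(count_predC (predC1 k)) -[X in X < _]addn0 ltn_add2l -has_count.
      by apply/hasP; exists k; [exact: Js|rewrite /= negbK].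
    rewrite mem_filter; apply/andP; split.
      by apply/eqP => lk; apply: nJkl; right.
    by apply: Js => Jl; apply: nJkl; left.
  apply: generated_sub; first exact: generated_subgroup.
  move=> y hy; apply: sub_generated; case: hy => [Ty|[l nl ly]]; [by left|right].
  by exists l => // Jl; apply: nl; left.
move=> nmiss; have [[k nJk]|nJ] := pselect (exists k, ~ J k).
  apply: (subset_trans _ (@sub_generated _ _)) => x Jx; right; exists k => //.
  apply: parabolicsS x Jx => i /= ik; apply: contrapT => nJi.
  by apply: nmiss; exists i, k.
apply: (subset_trans _ (@sub_generated _ _)) => x Jx; left.
by apply: parabolicsS x Jx => k _; apply: contrapT => nJk; apply: nJ; exists k.
Qed.

Section Action.
Variables (Ia : Type) (A B : groupType) (alpha : coset_system Ia A).
Variable eta : parabolic_action B alpha.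

Lemma idx_actK b k : idx_act eta b^-1 (idx_act eta b k) = k.
Proof. by rewrite -idx_actM mulVg idx_act1. Qed.

Lemma par_act_mem b k a : alpha (idx_act eta b k) (eta b a) <-> alpha k a.
Proof.
split=> [|ka]; last by rewrite -par_actE; exists a.
by rewrite -par_actE => -[c kc /(can_inj (aut_actK eta b)) <-].
Qed.

Lemma orbit_full (k : Ia) : [set idx_act eta b k | b in setT]
  \in orbits (idx_act eta).
Proof. by apply/mem_set; exists k. Qed.

Definition orbit_of k : orbits (idx_act eta) := SigSub (orbit_full k).

Lemma mem_orbit_of k : val (orbit_of k) k.
Proof. by exists 1 => //; rewrite idx_act1. Qed.

Lemma orbit_ofP (L : orbits (idx_act eta)) k : val L k <-> L = orbit_of k.
Proof.
split=> [|->]; last exact: mem_orbit_of.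
move=> Lk; apply: val_inj => /=; case: L Lk => L /= /[dup] /set_mem [l _ <-] _.
case=> b _ <-; apply/seteqP; split=> _ [c _ <-].
  by exists (c * b^-1) => //; rewrite -idx_actM mulgVK.
by exists (c * b) => //; rewrite idx_actM.
Qed.

End Action.

Section TwistingHypertope.
Variables (Ia : Type) (Ib : Type) (A B : groupType).
Variables (alpha : coset_system Ia A) (beta : coset_system Ib B).
Variables (eta : parabolic_action B alpha) (rep : orbit_reps (idx_act eta)).

Local Notation K := (set_type (orbits (idx_act eta))).
Local Notation "b • k" := (idx_act eta b k) (at level 40).
Local Notation T := (twisting beta eta rep).

(** Admissibility for intersections of arbitrary families; binary intersections
    do not suffice for the twisting to be thin and residually connected when
    the index set of $\beta$ is infinite. *)
Definition fully_admissible : Prop :=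
  forall (L : K) (J : set Ib) k, val L k ->
  (forall i, J i -> exists2 b, beta i b & b • rep L = k) ->
  exists2 b, parabolics beta J b & b • rep L = k.

Lemma fully_admissible_admissible :
  fully_admissible -> admissible beta eta rep.
Proof.
move=> adm L M N; apply/seteqP; split=> [k [[b Mb bk] [c Nc ck]]|].
  apply: adm; first by rewrite -bk; apply: orbit_stable; exact: orbit_repP.
  move=> i MNi; have [Mi|nMi] := pselect (M i).
    by exists c => //; apply: Nc => Ni; exact: MNi.
  by exists b => //; exact: Mb.
move=> _ [b MNb <-]; split; exists b => //; apply: parabolicsS b MNb;
  by apply: subsetC => i [].
Qed.

Hypothesis adm : fully_admissible.
Hypothesis fix_rep : forall (L : K) b, parabolics beta setT b -> b • rep L = rep L.

(** For t in the index set of $\beta$ this is the union over the orbits L of the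
    differences $L\setminus\mathcal{O}_L^t$, written through the orbit of the
    index itself. *)
Definition deleted (t : Ib + K) : set Ia :=
  match t with
  | inl i => [set k | ~ exists2 b, beta i b & b • rep (orbit_of eta k) = k]
  | inr L => val L
  end.

Definition top_part (t : Ib + K) (b : B) : Prop :=
  match t with inl i => beta i b | inr _ => True end.

Lemma twistE t (g : sdprod eta) :
  T t g <-> (forall k, deleted t k -> alpha k g.1) /\ top_part t g.2.
Proof.
case: t => [i|L] /=; split.
- move=> [/= Dg ig]; split=> // k nk; apply: Dg.
  exists (orbit_of eta k) => //; split; first exact: mem_orbit_of.
  by case=> b ib bk; apply: nk; exists b.
- move=> [Dg ig]; split=> //= k [L _ [/orbit_ofP Lk nk]]; apply: Dg.
  by move=> [b ib bk]; apply: nk; exists b; rewrite ?Lk.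
- by case.
- by move=> [Lg _]; split.
Qed.

Lemma deleted_act t b k : top_part t b -> deleted t k -> deleted t (b • k).
Proof.
case: t => [i|L] /= tb; last exact: orbit_stable.
move=> nk [c ic]; have <- : orbit_of eta k = orbit_of eta (b • k).
  by apply/orbit_ofP/orbit_stable/mem_orbit_of.
move=> ck; apply: nk; exists (b^-1 * c).
  by apply: subgroupM => //; [|apply: subgroupV => //];
    exact: parabolic_subgroup.
by rewrite idx_actM ck idx_actK.
Qed.

Lemma rep_not_deleted t L : t <> inr L -> ~ deleted t (rep L).
Proof.
have Lrep := (orbit_ofP L (rep L)).1 (orbit_repP rep L).
case: t => [i _|L' nLL'] /=.
  apply; exists 1; rewrite -?Lrep ?idx_act1 //.
  by apply: subgroup1; exact: parabolic_subgroup.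
by move=> /orbit_ofP; rewrite -Lrep => e; apply: nLL'; rewrite e.
Qed.

Lemma not_deletedP (J : set (Ib + K)) k :
  (forall t, J t -> ~ deleted t k) ->
  exists2 b, parabolics beta [set i | J (inl i)] b & b • rep (orbit_of eta k) = k.
Proof.
move=> nk; apply: adm; first exact: mem_orbit_of.
by move=> i /= Ji; apply: contrapT; exact: nk Ji.
Qed.

(** The projections of the cosets to B have a common point b.  After moving the
    base point of each coset to b, its part in A is an intersection of cosets
    of the subgroups $A_{bk}$ with k deleted, and the Helly property of
    $\alpha$ applies to all of these at once. *)
Lemma twist_helly : helly alpha -> helly beta -> helly T.
Proof.
move=> hA hB R cR.
have sdE (g h : sdprod eta) : g^-1 * h = (eta g.2^-1 (g.1^-1 * h.1), g.2^-1 * h.2).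
  by rewrite aut_act_mul.
have cRE t u g h : R t g -> R u h -> exists z : sdprod eta,
    T t (eta g.2^-1 (g.1^-1 * z.1), g.2^-1 * z.2) /\
    T u (eta h.2^-1 (h.1^-1 * z.1), h.2^-1 * z.2).
  by move=> Rg Rh; have [z] := cR _ _ _ _ Rg Rh; rewrite !sdE; exists z.
have [|b bP] := hB (fun i x => exists2 g, R (inl i) g & x = g.2).
  move=> i k _ _ [g Rg ->] [h Rh ->].
  have [z [/twistE [_ tz] /twistE [_ uz]]] := cRE _ _ _ _ Rg Rh.
  by exists z.2.
have top t g : R t g -> top_part t (g.2^-1 * b).
  by case: t => //= i Rg; apply: bP; exists g.

(* The indices deleted from the part of type t of the coset g T_t are the
   g.2-translates, hence also the b-translates, of those deleted from T_t. *)
have delP t g a : R t g -> (forall k, deleted t k -> alpha k (eta g.2^-1 a)) <->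
    (forall k, deleted t k -> alpha (b • k) a).
  move=> /top tb; split=> Da k tk.
    have := Da _ (deleted_act tb tk).
    by rewrite idx_actM => /par_act_mem.
  have sT : subgroup (top_part t : set B).
    by case: (t) => [i|L] /=; [exact: parabolic_subgroup|split].
  have := Da _ (deleted_act (subgroupV sT tb) tk).
  rewrite invgM invgK -idx_actM mulVKg => /(par_act_mem eta g.2^-1).
  by rewrite idx_actK.
have [|a aP] := hA (fun l x => exists t g k,
    [/\ R t g, deleted t k, l = b • k & x = g.1]).
  move=> _ _ _ _ [t [g [k [Rg tk -> ->]]]] [u [h [l [Rh ul -> ->]]]].
  have [z [/twistE [/= /(delP _ _ _ Rg) Dz _] /twistE [/= /(delP _ _ _ Rh) Dz' _]]]
    := cRE _ _ _ _ Rg Rh.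
  by exists z.1; split; [exact: Dz|exact: Dz'].
exists (a, b) => t g Rg; rewrite sdE; apply/twistE; split; last exact: top.
by apply/(delP _ _ _ Rg) => k tk; apply: aP; exists t, g, k.
Qed.

Lemma sd_mul_pair (a : A) (b : B) : ((a, 1) : sdprod eta) * (1, b) = (a, b).
Proof. by rewrite /mul /= /sd_mul /= aut_act_1 mulg1 mul1g. Qed.

Lemma sd_conj (c : B) (a : A) : ((eta c a, 1) : sdprod eta) =
  ((1, c) : sdprod eta) * (((a, 1) : sdprod eta) / ((1, c) : sdprod eta)).
Proof.
apply: (etrans _ (erefl (sd_mul (1, c) (sd_mul (a, 1) (sd_inv (1, c)))))).
by rewrite /sd_mul /sd_inv /= invg1 !aut_act_1 mulg1 !mul1g mulgV.
Qed.

(** For a type i of $\beta$ the element s comes from B.  For an orbit L it comes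
    from A: an index of L that is deleted in no type other than L is a
    $B_i$-translate of the representative for every i, hence a translate by the
    intersection of the $B_i$, hence the representative itself. *)
Lemma twist_thin : thin_parabolics alpha -> thin_parabolics beta ->
  thin_parabolics T.
Proof.
move=> tA tB [i|L].
  have [s [Ps nPs sP]] := tB i; exists (1, s); split.
  - move=> t nti; apply/twistE; split=> [k _|].
      by apply: subgroup1; exact: parabolic_subgroup.
    case: t nti => //= k nki; apply: Ps => /= ki; apply: nki.
    by rewrite /= ki.
  - by move=> /twistE [].
  - move=> [a b] Pab; have Aa k : alpha k a.
      have /twistE [Da _] : T (inr (orbit_of eta k)) (a, b) by exact: Pab.
      by apply: Da; exact: mem_orbit_of.
    have Bb : parabolics beta (~` [set i]) b.
      move=> k nki; suff /twistE [] : T (inl k) (a, b) by [].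
      by apply: Pab => -[].
    have [ib|isb] := sP b Bb; [left|right]; apply/twistE; split=> //= k _.
    rewrite -aut_act_mul; have := Aa (s • k).
    rewrite -(par_act_mem eta s^-1) idx_actK.
    by rewrite invg1 mul1g.
have [s [Ps nPs sP]] := tA (rep L); exists (s, 1); split.
- move=> t ntL; apply/twistE; split=> [k tk|].
    by apply: Ps => /= kL; apply: (rep_not_deleted ntL); rewrite -kL.
  by case: t {ntL} => //= i; apply: subgroup1; exact: parabolic_subgroup.
- by move=> /twistE [/= sL _]; apply/nPs/sL; exact: orbit_repP.
- move=> [a b] Pab; have Aa : parabolics alpha (~` [set rep L]) a.
    move=> k /= nkL; have [t [ntL tk]] : exists t, t <> inr L /\ deleted t k.
      apply: contrapT => nt.
      have [t /= ntL tk|c cB] := @not_deletedP (~` [set inr L]) k.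
        by apply: nt; exists t.
      rewrite fix_rep; last by move=> i _; apply: cB.
      have [<-|LL'] := pselect (L = orbit_of eta k); first by move/esym.
      move=> _; apply: nt; exists (inr (orbit_of eta k)).
      by split; [move=> [/esym]|exact: mem_orbit_of].
    by have /twistE [Da _] := Pab t ntL; exact: Da.
  have AL (c : A) : alpha (rep L) c ->
      parabolics alpha (~` [set rep L]) c -> T (inr L) (c, b).
    move=> Lc Pc; apply/twistE; split=> //= k _.
    by have [->|nk] := pselect (k = rep L); [|exact: Pc].
  have [La|Lsa] := sP a Aa; [left|right]; first exact: AL.
  have -> : ((s, 1) : sdprod eta)^-1 * (a, b) = (s^-1 * a, b).
    by rewrite /mul /inv /= /sd_mul /= invg1 !aut_act1 mul1g.
  have sL := parabolics_subgroup alpha (~` [set rep L]).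
  by apply: AL => //; exact: (subgroupM sL (subgroupV sL Ps) Aa).
Qed.

Lemma twist_core_free : core_free alpha -> core_free beta -> core_free T.
Proof.
move=> fA fB [a b] ab.
have b1 : b = 1.
  by apply: fB => i x; have /twistE [] := ab (inl i) (1, x).
subst b; congr pair; apply: fA => k x.
have /twistE [/= + _] := ab (inr (orbit_of eta k)) (x, 1).
move=> /(_ k (mem_orbit_of eta k)).
by rewrite /= !invg1 mul1g !aut_act1.
Qed.

(** Write an element of the intersection as (a, 1) (1, b).  The part in B is
    covered by a missing orbit if there is one, whose parabolic contains all of
    B, and otherwise by residual generation in $\beta$.  For the part in A one
    may take a in the minimal parabolic at an index that is not deleted; up
    to conjugation by B this index is the representative of its orbit L, and
    then (a, 1) lies in the parabolics of all types other than L, one of which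
    is missing. *)
Lemma twist_residually_generated :
  (forall J, parabolics alpha J `<=` generated (minimal_parabolics alpha J)) ->
  residually_generated beta -> residually_generated T.
Proof.
move=> gA gB J [u [v [uv nJu nJv]]] [a b] Jab.
set H := generated _; have sH : subgroup H := generated_subgroup _.
have HI t (g : sdprod eta) : ~ J t -> T t g -> parabolics T J g -> H g.
  by move=> nJt tg Jg; apply: sub_generated; exists t => // w [/Jg|->].
pose JB := [set i | J (inl i)].
have topJ c : (forall i, JB i -> beta i c) -> parabolics T J (1, c).
  move=> Bc t Jt; apply/twistE; split=> [k _|].
    by apply: subgroup1; exact: parabolic_subgroup.
  by case: t Jt => //= i Ji; exact: Bc.
have topH c : parabolics beta JB c -> H (1, c).
  have [[L nJL]|allJ] := pselect (exists L, ~ J (inr L)).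
    move=> Bc; apply: (HI _ _ nJL); last exact: topJ.
    apply/twistE; split=> // k _.
    by apply: subgroup1; exact: parabolic_subgroup.
  have J2 : exists i k, [/\ i <> k, ~ JB i & ~ JB k].
    have JL L : J (inr L) by apply: contrapT => nJL; apply: allJ; exists L.
    case: u v uv nJu nJv => [i|L] [k|L'] uv nJu nJv //;
      try by [case: nJu; exact: JL|case: nJv; exact: JL].
    by exists i, k; split=> // ik; apply: uv; rewrite ik.
  move=> /(gB JB J2); apply: (generated_sub (H := [set c | H (1, c)])).
    split=> [|x y Hx Hy]; first exact: (subgroup1 sH).
    have := sH.2 _ _ Hx Hy.
    by rewrite /mul /inv /= /sd_mul /= invg1 !aut_act_1 mulg1.
  move=> {}c [i nJi Bc]; apply: (HI _ _ nJi); last first.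
    by apply: topJ => k Jk; apply: Bc; left.
  apply/twistE; split=> [k _|]; last by apply: Bc; right.
  by apply: subgroup1; exact: parabolic_subgroup.
rewrite -sd_mul_pair; apply: (subgroupM sH); last first.
  by apply: topH => i Ji; have /twistE [] := Jab _ Ji.
pose D := [set k | exists2 t, J t & deleted t k].
have : parabolics alpha D a.
  by move=> k [t Jt tk]; have /twistE [Da _] := Jab _ Jt; exact: Da.
have botT t c : (forall k, deleted t k -> alpha k c) -> T t (c, 1).
  move=> Dc; apply/twistE; split=> //.
  by case: (t) => //= i; apply: subgroup1; exact: parabolic_subgroup.
move/gA; apply: (generated_sub (H := [set c | H (c, 1)])).
  split=> [|x y Hx Hy]; first exact: (subgroup1 sH).
  have := sH.2 _ _ Hx Hy.
  by rewrite /mul /inv /= /sd_mul /= invg1 !aut_act1 mulg1.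
move=> {}a {Jab} [Aa|[k nDk ka]].
  have Ta t : T t (a, 1) := botT t a (fun k _ => Aa k I).
  by apply: (HI u) => // t _; exact: Ta.
have [t Jt tk|c JBc ck] := @not_deletedP J k; first by apply: nDk; exists t.
set L := orbit_of eta k in ck.
have nJL : ~ J (inr L).
  by move=> JL; apply: nDk; exists (inr L) => //; exact: mem_orbit_of.
(* Conjugating by c brings the generator to the base element of its orbit. *)
suff : H (a, 1) by [].
rewrite -(aut_actKV eta c a) sd_conj.
apply: (subgroupM sH); first exact: topH.
apply: (subgroupM sH); last by apply: (subgroupV sH); exact: topH.
have La : parabolics alpha (~` [set rep L]) (eta c^-1 a).
  move=> l /= lL; rewrite -[l](idx_actK eta c); apply/par_act_mem; apply: ka.
  move=> /= /(congr1 (idx_act eta c^-1)); rewrite idx_actK.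
  by rewrite -ck idx_actK.
have LT t : t <> inr L -> T t (eta c^-1 a, 1).
  move=> ntL; apply/botT => l tl; apply: La => /= lL.
  by apply: (rep_not_deleted ntL); rewrite -lL.
have [w [nJw nwL]] : exists w, ~ J w /\ w <> inr L.
  have [uL|] := pselect (u = inr L); last by exists u.
  by exists v; split=> // vL; apply: uv; rewrite uL vL.
apply: (HI w) => //; first exact: LT.
by move=> t Jt; apply: LT => tL; apply: nJL; rewrite -tL.
Qed.

End TwistingHypertope.

Theorem twisting_regular_hypertope (Ia : choiceType) (Ib : Type)
    (A B : groupType) (alpha : coset_system Ia A) (beta : coset_system Ib B)
    (eta : parabolic_action B alpha) (rep : orbit_reps (idx_act eta)) :
  finite_set [set: Ia] -> fully_admissible beta rep ->
  (forall L b, parabolics beta setT b -> idx_act eta b (rep L) = rep L) ->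
  regular_hypertope alpha -> regular_hypertope beta ->
  regular_hypertope (twisting beta eta rep).
Proof.
move=> finI adm fixI /regular_hypertopeP [hA tA gA fA].
move=> /regular_hypertopeP [hB tB gB fB]; apply/regular_hypertopeP; split.
- exact: twist_helly.
- exact: twist_thin.
- apply: twist_residually_generated => //.
  exact: generated_minimal_parabolics.
- exact: twist_core_free.
Qed.

(** * Linear reflections of prescribed orders *)

Section Reflections.
Import GRing.Theory.
Local Open Scope ring_scope.
Variables (F : fieldType) (X : Type) (c : X -> X -> F).

(** The reflections of the contragredient geometric representation: phi gives
    the values of a linear form on the simple roots. *)
Definition reflect_form (s : X) (phi : X -> F) : X -> F :=
  fun u => phi u + c s u * phi s.

Lemma reflect_formK s : c s s = - 2 -> involutive (reflect_form s).
Proof. by move=> css phi; apply: funext => u; rewrite /reflect_form css; ring. Qed.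

(** On the values at x and y the product of the two reflections acts with
    eigenvalues $z^2$ and $z^{-2}$, the eigenvectors being the combinations of
    f x and f y with coefficients 1 and z or $z^{-1}$. *)
Lemma reflect_form_order x y z n : c x x = - 2 -> c y y = - 2 ->
  c x y = z + z^-1 -> c y x = z + z^-1 -> z != 0 -> z ^+ 2 != 1 ->
  z ^+ n.*2 = 1 -> forall phi, iter n (reflect_form x \o reflect_form y) phi = phi.
Proof.
move=> cxx cyy cxy cyx z0 z2 zn phi.
set T := reflect_form x \o reflect_form y.
have Tx f : T f x = - (f x + c y x * f y).
  by rewrite /T /= /reflect_form cxx; ring.
have Ty f : T f y = - f y + c x y * (f x + c y x * f y).
  by rewrite /T /= /reflect_form cyy; ring.
have Tu f u : T f u = f u + c y u * f y + c x u * (f x + c y x * f y).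
  by rewrite /T /= /reflect_form.
have eig w : w = z \/ w = z^-1 -> forall k,
    iter k T phi x + w * iter k T phi y = w ^+ k.*2 * (phi x + w * phi y).
  move=> wz; elim=> [|k IH]; first by rewrite expr0 mul1r.
  rewrite iterS Tx Ty doubleS !exprS -!mulrA -IH cxy cyx.
  by case: wz => ->; field.
have zVn : z^-1 ^+ n.*2 = 1 by rewrite exprVn zn invr1.
(* After n steps both eigenvalues become 1, so f x and f y return to themselves. *)
have ex := eig z (or_introl erefl) n; have ey := eig z^-1 (or_intror erefl) n.
rewrite zn mul1r in ex; rewrite zVn mul1r in ey.
have zz : z - z^-1 != 0.
  by apply: contraNneq z2 => zz; rewrite expr2 -[X in X * _](subrK z^-1 z) zz;
    rewrite add0r mulVf.
have ny : iter n T phi y = phi y.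
  have e f : (z - z^-1) * f y = (f x + z * f y) - (f x + z^-1 * f y) by ring.
  by apply: (mulfI zz); rewrite !e ex ey.
have nx : iter n T phi x = phi x by move: ex; rewrite ny => /addIr.
(* Since the form is nondegenerate on the plane of x and y, some combination of
   f u, f x and f y is fixed by T. *)
apply: funext => u; pose D := 4 - c x y ^+ 2.
have D0 : D != 0.
  have -> : D = - (z - z^-1) ^+ 2 by rewrite /D cxy; field.
  by rewrite oppr_eq0 expf_neq0.
pose inv f := D * f u + (2 * c x u + c x y * c y u) * f x
  + (2 * c y u + c x y * c x u) * f y.
have invT k : inv (iter k T phi) = inv phi.
  elim: k => // k <-; rewrite iterS; set f := iter k T phi.
  by rewrite /inv Tx Ty Tu /D cyx -cxy; ring.
have := invT n; rewrite /inv nx ny => /addIr /addIr.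
exact: mulfI.
Qed.

End Reflections.

Section CoxeterLabels.
Import GRing.Theory.
Local Open Scope ring_scope.
Variables (X : choiceType) (m : X -> X -> option nat).
Hypothesis m_sym : forall x y, m x y = m y x.
Hypothesis m_ge2 : forall x y n, x != y -> m x y = Some n -> (1 < n)%N.

(** A primitive root of unity of order 2n, so that for $z = e^{\pi i/n}$ the
    pairing $z + z^{-1}$ is the usual $2\cos(\pi/n)$; the successor of the
    predecessor serves to exhibit 2n as a positive number. *)
Definition coxeter_root (n : nat) : algC :=
  sval (C_prim_root_exists (ltn0Sn n.*2.-1)).

Definition coxeter_form (x y : X) : algC :=
  if x == y then - 2 else
  if m x y is Some n then coxeter_root n + (coxeter_root n)^-1 else 0.

Lemma coxeter_form_involutive s : involutive (reflect_form coxeter_form s).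
Proof. by apply: reflect_formK; rewrite /coxeter_form eqxx. Qed.

Lemma coxeter_form_order x y n : x != y -> m x y = Some n -> forall phi,
  iter n (reflect_form coxeter_form x \o reflect_form coxeter_form y) phi = phi.
Proof.
move=> xy mxy; have n1 := m_ge2 xy mxy.
have zP : (n.*2.-1.+1).-primitive_root (coxeter_root n).
  exact: (svalP (C_prim_root_exists (ltn0Sn n.*2.-1))).
rewrite prednK ?double_gt0 ?(ltnW n1) // in zP.
have zn := prim_expr_order zP.
apply: (@reflect_form_order _ _ _ _ _ (coxeter_root n)) => //.
- by rewrite /coxeter_form eqxx.
- by rewrite /coxeter_form eqxx.
- by rewrite /coxeter_form (negbTE xy) mxy.
- by rewrite /coxeter_form eq_sym (negbTE xy) m_sym mxy.
- apply: contraTneq (oner_neq0 algC) => z0.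
  by rewrite -zn z0 expr0n double_eq0 -leqn0 leqNgt (ltnW n1) eqxx.
- rewrite -(prim_order_dvd zP); apply/negP => /dvdn_leq h.
  by have := leq_double n 1; rewrite h // leqNgt n1.
Qed.
End CoxeterLabels.

(** * Coxeter groups and their coset systems *)

Section CoxeterGroup.
Variables (X : choiceType) (m : X -> X -> option nat).
Hypothesis m_sym : forall x y, m x y = m y x.
Hypothesis m_ge2 : forall x y n, x != y -> m x y = Some n -> 1 < n.
Variable R : set (word X).
Hypothesis RE : forall r, R r <->
  (exists x, r = [:: (x, false); (x, false)]) \/
  (exists x y n, [/\ x != y, m x y = Some n &
     r = flatten (nseq n [:: (x, false); (y, false)])]).

Local Notation W := (presented R).
Local Notation gen := (presented_gen R).
Implicit Types (x y s : X) (t u : W) (v w : seq X) (S : set X).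

Definition gprod w : W := foldr (fun s u => gen s * u) 1 w.

Lemma gprod_cat v w : gprod (v ++ w) = gprod v * gprod w.
Proof. by elim: v => [|s v IH] /=; rewrite ?mul1g // IH mulgA. Qed.

Lemma gprod_rcons w s : gprod (rcons w s) = gprod w * gen s.
Proof. by rewrite -cats1 gprod_cat /= mulg1. Qed.

Lemma gen_word_class s r : gen s * word_class R r = word_class R ((s, false) :: r).
Proof. by rewrite -[(s, false) :: r]cat1s word_class_cat. Qed.

Lemma word_class_gprod w : word_class R [seq (s, false) | s <- w] = gprod w.
Proof. by elim: w => //= s w <-; rewrite gen_word_class. Qed.

Lemma gen_sq s : gen s * gen s = 1.
Proof.
rewrite {2}/presented_gen gen_word_class -word_class_nil.
by apply/word_classP/wequiv_rel/RE; left; exists s.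
Qed.

Lemma genV s : (gen s)^-1 = gen s.
Proof. by apply: mulg1_eq; exact: gen_sq. Qed.

Lemma gen_order x y n : x != y -> m x y = Some n -> (gen x * gen y) ^+ n = 1.
Proof.
move=> xy mxy.
have -> : (gen x * gen y) ^+ n =
    word_class R (flatten (nseq n [:: (x, false); (y, false)])).
  elim: n {mxy} => [//|n IH]; rewrite expgS IH /=.
  by rewrite -mulgA [gen y * _]gen_word_class gen_word_class.
rewrite -word_class_nil; apply/word_classP/wequiv_rel/RE.
by right; exists x, y, n.
Qed.

Lemma gprod_surj u : exists w, gprod w = u.
Proof.
rewrite -(word_repr u); elim: (repr u) => [|[s e] r [w rE]]; first by exists [::].
exists (s :: w); rewrite -[(s, e) :: r]cat1s word_class_cat -rE /=; congr (_ * _).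
case: e => //; rewrite -genV; apply: mulg1_eq.
by rewrite gen_word_class; apply/word_classP; exact: (wequiv_cancel R s false).
Qed.

Section Lift.
Variables (Y : Type) (act : X -> Y -> Y).
Hypothesis act_sq : forall s, involutive (act s).
Hypothesis act_order : forall x y n, x != y -> m x y = Some n ->
  forall z, iter n (act x \o act y) z = z.

(** The universal property of the Coxeter group for actions: involutions of Y
    that satisfy the relations let a word act through its value. *)
Lemma foldr_act_gprod v w z : gprod v = gprod w -> foldr act z v = foldr act z w.
Proof.
rewrite -!word_class_gprod => /word_classP vw.
have lift r r' : wequiv R r r' -> forall z,
    foldr act z (unzip1 r) = foldr act z (unzip1 r').
  elim=> {r r'} //.
  - move=> r r' q _ IH _ IH' y; exact: etrans (IH y) (IH' y).
  - move=> r r' q q' _ IH _ IH' y; rewrite /unzip1 !map_cat !foldr_cat.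
    by rewrite IH' IH.
  - by move=> s e y /=; rewrite act_sq.
  move=> r /RE [[s ->] y|[x [y [n [xy mxy ->]]]] y0] /=; first exact: act_sq.
  rewrite -[RHS](act_order xy mxy y0).
  by elim: (n) => //= k ->.
by have := lift _ _ vw z; rewrite /unzip1 -!map_comp !map_id.
Qed.

End Lift.

(** Tits' action on signed elements: the generator conjugates, and changes the
    sign exactly of itself.  It will record the parity with which a reflection
    occurs among those attached to a word. *)
Definition tits_act s (p : W * bool) : W * bool :=
  (gen s * p.1 * gen s, p.2 (+) (p.1 == gen s)).

Lemma tits_act_sq s : involutive (tits_act s).
Proof.
move=> [t e]; rewrite /tits_act /= !mulgA gen_sq mul1g -mulgA gen_sq mulg1.
congr pair; have -> : (gen s * t * gen s == gen s) = (t == gen s).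
  apply/eqP/eqP => [e0|->]; last by rewrite gen_sq mul1g.
  by apply: (mulgI (gen s)); apply: (mulIg (gen s)); rewrite e0 gen_sq mul1g.
by rewrite -addbA addbb addbF.
Qed.

(** Conjugation by y inverts d, so within k rounds t is moved onto y or x once
    for each i < 2k such that t is $y d^i$. *)
Lemma iter_tits_act x y k t e : let d := gen x * gen y in
  iter k (tits_act x \o tits_act y) (t, e) =
  (d ^+ k * t / d ^+ k,
   e (+) \big[addb/false]_(0 <= i < k.*2) (t == gen y * d ^+ i)).
Proof.
move=> d; have dE : d = gen x * gen y by [].
have dV : d^-1 = gen y * gen x by rewrite invgM !genV.
clearbody d.
have dy i : d ^- i * gen y = gen y * d ^+ i.
  have dyV : d^-1 ^ gen y = d.
    by rewrite conjgE genV dV !mulgA gen_sq mul1g dE.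
  have := conjXg (d^-1) (gen y) i; rewrite dyV expVgn conjgE => e0.
  by apply: (mulgI (gen y)^-1); rewrite e0 mulKg.
elim: k => [|k IH]; first by rewrite expg0 mul1g invg1 mulg1 big_geq // addbF.
rewrite iterS IH /tits_act /=; congr pair.
  by rewrite expgS invgM dV {3}dE !mulgA.
rewrite doubleS !big_nat_recr //= -!addbA; congr (_ (+) (_ (+) _)).
have conj z : (d ^+ k * t / d ^+ k == z) = (t == d ^- k * z * d ^+ k).
  apply/eqP/eqP => [<-|->]; last by rewrite mulgA mulgK mulVKg.
  by rewrite -!mulgA mulVg mulg1 mulKg.
rewrite conj dy -mulgA -expgnDr addnn; congr (_ (+) _).
have -> : (gen y * (d ^+ k * t / d ^+ k) * gen y == gen x) =
    (d ^+ k * t / d ^+ k == gen y * d).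
  move: (d ^+ k * t / d ^+ k) => z; rewrite dE; apply/eqP/eqP => [<-|->].
    by rewrite -!mulgA gen_sq mulg1 mulgA gen_sq mul1g.
  by rewrite !mulgA gen_sq mul1g -mulgA gen_sq mulg1.
rewrite conj (mulgA _ _ d) dy -!mulgA -expgS -expgnDr.
by rewrite addnS addnn.
Qed.

(** As $d^n = 1$, the elements $y d^i$ for i < n and for $n\le i$ < 2n are the
    same, so that the sign changes cancel. *)
Lemma tits_act_order x y n : x != y -> m x y = Some n ->
  forall p, iter n (tits_act x \o tits_act y) p = p.
Proof.
move=> xy mxy [t e]; rewrite iter_tits_act; have d1 := gen_order xy mxy.
rewrite d1 mul1g invg1 mulg1 -addnn; congr pair.
rewrite (@big_cat_nat _ _ _ n) ?leq_addr //= -{2}[n]add0n big_addn addnK.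
under [X in _ (+) (_ (+) X)]eq_bigr do rewrite expgnDr d1 mulg1.
by rewrite addbb addbF.
Qed.

(** The sign that the word w gives to t; by the relations it depends only on
    the value of w. *)
Definition flip w t : bool := (foldr tits_act (t, false) w).2.

Lemma foldr_tits_act w t e :
  foldr tits_act (t, e) w = (gprod w * t / gprod w, e (+) flip w t).
Proof.
rewrite /flip; elim: w e => [|s w IH] e /=.
  by rewrite mul1g invg1 mulg1 addbF.
rewrite IH [in RHS](IH false) /tits_act /= invgM genV !mulgA; congr pair.
by rewrite addbA.
Qed.

Lemma flip_cat v w t : flip (v ++ w) t = flip w t (+) flip v (gprod w * t / gprod w).
Proof. by rewrite {1}/flip foldr_cat foldr_tits_act foldr_tits_act. Qed.

Lemma flip1 s t : flip [:: s] t = (t == gen s).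
Proof. by []. Qed.

Lemma flip_rcons w s t : flip (rcons w s) t = (t == gen s) (+) flip w (gen s * t * gen s).
Proof. by rewrite -cats1 flip_cat flip1 /= mulg1 genV. Qed.

Lemma flip_gprod v w t : gprod v = gprod w -> flip v t = flip w t.
Proof.
move=> vw; congr snd; apply: foldr_act_gprod vw; first exact: tits_act_sq.
exact: tits_act_order.
Qed.

(** A sign change occurs when some letter s of w meets the conjugate of t by
    the letters to its right in s itself; multiplying by t then cancels that
    letter.  This is the exchange condition. *)
Lemma flip_delete w t : flip w t -> exists w1 s w2,
  w = w1 ++ s :: w2 /\ gprod w * t = gprod (w1 ++ w2).
Proof.
elim: w => // s w IH; rewrite -cat1s flip_cat flip1 /=.
case: (boolP (flip w t)) => [/IH [w1 [x [w2 [-> e]]]] _|_ /= /eqP wt].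
  by exists (s :: w1), x, w2; rewrite /= -mulgA e.
exists [::], s, w; split=> //=.
have e : gprod w * t = gen s * gprod w by rewrite -wt mulgVK.
by rewrite -mulgA e mulgA gen_sq mul1g.
Qed.

Definition reduced w := forall v, gprod v = gprod w -> size w <= size v.

Lemma size_minimal (P : seq X -> Prop) : (exists w, P w) ->
  exists w, P w /\ forall v, P v -> size w <= size v.
Proof.
move=> [w0 Pw0]; have ex : exists n, `[< exists w, P w /\ size w = n >].
  by exists (size w0); apply/asboolP; exists w0.
case: (ex_minnP ex) => n /asboolP [w [Pw <-]] minw.
by exists w; split=> // v Pv; apply: minw; apply/asboolP; exists v.
Qed.

Lemma reduced_gprod u : exists w, reduced w /\ gprod w = u.
Proof.
have [w [wu minw]] := size_minimal (gprod_surj u).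
by exists w; split=> // v; rewrite wu; exact: minw.
Qed.

Lemma reduced_cat v w : reduced (v ++ w) -> reduced v /\ reduced w.
Proof.
move=> rvw; split=> u eu.
  by have := rvw (u ++ w); rewrite !gprod_cat eu !size_cat leq_add2r; exact.
by have := rvw (v ++ u); rewrite !gprod_cat eu !size_cat leq_add2l; exact.
Qed.

(** If w flips s, exchange yields a shorter word for w s.  If not, then w s flips
    s, and so would a word v for w s that is not longer than w; exchange in v
    would give a word for w that is too short. *)
Lemma reduced_rcons w s : reduced w ->
  reduced (rcons w s) <-> ~~ flip w (gen s).
Proof.
have size_del w1 (x : X) w2 : size (w1 ++ x :: w2) = (size (w1 ++ w2)).+1.
  by rewrite !size_cat addnS.
move=> rw; split=> [rws|].
  apply/negP => /flip_delete [w1 [x [w2 [ew e]]]].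
  have := rws (w1 ++ w2); rewrite gprod_rcons e size_rcons ew size_del.
  by move=> /(_ erefl); rewrite ltnNge leqnSn.
move=> nf v ev; rewrite leqNgt; apply/negP => vw.
have : flip v (gen s).
  by rewrite (flip_gprod _ ev) flip_rcons eqxx gen_sq mul1g addTb.
move/flip_delete => [v1 [x [v2 [e]]]].
rewrite ev gprod_rcons -mulgA gen_sq mulg1 => /esym /rw.
rewrite leqNgt => /negP; apply.
by move: vw; rewrite size_rcons ltnS e size_del.
Qed.

(** The word w s flips s, hence so does every word v with the same value. *)
Lemma reduced_last w s v : reduced (rcons w s) -> gprod v = gprod (rcons w s) ->
  exists v1 x v2, v = v1 ++ x :: v2 /\ gprod w = gprod (v1 ++ v2).
Proof.
move=> rws ev; have [|v1 [x [v2 [e ed]]]] := @flip_delete v (gen s).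
  rewrite (flip_gprod _ ev) flip_rcons eqxx gen_sq mul1g addTb.
  apply/reduced_rcons => //.
  by move: rws; rewrite -cats1 => /reduced_cat [].
exists v1, x, v2; split=> //.
by rewrite -ed ev gprod_rcons -mulgA gen_sq mulg1.
Qed.

Definition word_in S w := {in w, forall s, S s}.

Definition special S : set W := [set u | exists2 w, word_in S w & gprod w = u].

Lemma special_subgroup S : subgroup (special S).
Proof.
split=> [|_ _ [v Sv <-] [w Sw <-]]; first by exists [::].
exists (v ++ rev w).
  by move=> s; rewrite mem_cat mem_rev => /orP [/Sv|/Sw].
rewrite gprod_cat; congr (_ * _).
elim: w {Sw} => [|s w IH] /=; first by rewrite invg1.
by rewrite rev_cons gprod_rcons IH invgM genV.
Qed.

Lemma specialE S : special S = generated (gen @` S).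
Proof.
apply/seteqP; split=> [_ [w Sw <-]|].
  have sG := generated_subgroup (gen @` S).
  elim: w Sw => [|s w IH] Sw /=; first exact: subgroup1.
  apply: (subgroupM sG).
    apply: sub_generated; exists s => //; apply: Sw.
    by rewrite mem_head.
  by apply: IH => x xw; apply: Sw; rewrite in_cons xw orbT.
apply: generated_sub; first exact: special_subgroup.
move=> _ [s Ss <-]; exists [:: s]; last by rewrite /= mulg1.
by move=> x; rewrite inE => /eqP ->.
Qed.

(** The form that vanishes at the letters of S and is 1 at the others is fixed
    by the reflections from S, but the reflection of a letter s outside S
    changes its value at s to -1. *)
Lemma special_gen S s : special S (gen s) -> S s.
Proof.
move=> [w Sw ews]; apply: contrapT => nSs.
pose phi (x : X) : algC := (`[< ~ S x >]%:R)%R.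
have := @foldr_act_gprod _ (reflect_form (coxeter_form m))
  (coxeter_form_involutive m) (coxeter_form_order m_sym m_ge2) w [:: s] phi.
rewrite /= mulg1 => /(_ ews).
have -> : foldr (reflect_form (coxeter_form m)) phi w = phi.
  elim: w Sw {ews} => //= x w IH Sw; rewrite IH; last first.
    by move=> z zw; apply: Sw; rewrite in_cons zw orbT.
  apply: funext => z; rewrite /reflect_form.
  have -> : phi x = 0%R.
    rewrite /phi; case: asboolP => // nSx; case: nSx; apply: Sw.
    by rewrite mem_head.
  by rewrite GRing.mulr0 GRing.addr0.
move/(congr1 (fun f => f s)); rewrite /reflect_form /coxeter_form eqxx.
have -> : phi s = 1%R by rewrite /phi; case: asboolP.
rewrite GRing.mulr1 => /eqP; rewrite eq_sym -GRing.subr_eq0 GRing.addrAC.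
by rewrite GRing.subrr GRing.add0r GRing.oppr_eq0 Num.Theory.pnatr_eq0.
Qed.

(** Exchange against a word in the letters of S shows that removing the last
    letter of w keeps its value in the special subgroup; so that last letter
    lies there too. *)
Lemma special_reduced S w : reduced w -> special S (gprod w) -> word_in S w.
Proof.
elim/last_ind: w => // w s IH rws [v Sv ev].
have [v1 [x [v2 [e ew]]]] := reduced_last rws ev.
have Sw : special S (gprod w).
  exists (v1 ++ v2) => // z; rewrite mem_cat => zv; apply: Sv.
  by rewrite e mem_cat in_cons orbCA zv orbT.
have Ss : S s.
  apply: special_gen; have sS := special_subgroup S.
  have := subgroupM sS (subgroupV sS Sw) (ex_intro2 _ _ v Sv ev).
  by rewrite gprod_rcons mulKg.
have [rw _] : reduced w /\ reduced [:: s] by apply: reduced_cat; rewrite cats1.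
move=> z; rewrite mem_rcons in_cons => /orP [/eqP -> //|].
exact: IH.
Qed.

(** The shortest element g of the coset is a gate: if v is a reduced word in S,
    a letter that could be exchanged in the product of g and v would shorten
    either v or the representative g.  Hence a reduced word of any d in the
    coset can be chosen to start with one of g, and its letters lie in S'
    when d lies in the special subgroup of S'. *)
Lemma special_gate S u : exists g, special S (u^-1 * g) /\
  forall d S', special S (u^-1 * d) -> special S' d -> special S' g.
Proof.
have sS := special_subgroup S.
have [|w [Sw minw]] := @size_minimal (fun w => special S (u^-1 * gprod w)).
  have [w wu] := gprod_surj u; exists w; rewrite wu mulVg.
  exact: subgroup1.
exists (gprod w); split=> // d S' Sd S'd.
have red v : word_in S v -> reduced v -> reduced (w ++ v).
  elim/last_ind: v => [_ _|v s IH Svs rvs].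
    rewrite cats0 => v ev; apply: minw; by rewrite ev.
  have [rv _] : reduced v /\ reduced [:: s] by apply: reduced_cat; rewrite cats1.
  have Sv : word_in S v.
    by move=> z zv; apply: Svs; rewrite mem_rcons in_cons zv orbT.
  have Ss : special S (gen s).
    by rewrite specialE; apply: sub_generated; exists s => //; apply: Svs;
      rewrite mem_rcons mem_head.
  rewrite -rcons_cat; apply/(reduced_rcons _ (IH Sv rv)).
  rewrite flip_cat (negbTE ((reduced_rcons _ rv).1 rvs)) addFb.
  apply/negP => /flip_delete [w1 [x [w2 [ew e]]]].
  have := minw (w1 ++ w2); rewrite -e ew !size_cat addnS ltnn => absurd.
  suff : false by []; apply: absurd.
  rewrite mulgA; apply: (subgroupM sS); first by rewrite -ew.
  have Sgv : special S (gprod v) by exists v.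
  exact: (sS.2 _ _ (subgroupM sS Sgv Ss) Sgv).
have [v [rv ev]] := reduced_gprod ((gprod w)^-1 * d).
have Sv : word_in S v.
  apply: special_reduced rv _; rewrite ev.
  have := subgroupM sS (subgroupV sS Sw) Sd.
  by rewrite invgM invgK -mulgA mulVKg.
have S'wv : word_in S' (w ++ v).
  by apply: special_reduced (red v Sv rv) _; rewrite gprod_cat ev mulVKg.
exists w => // s sw; apply: S'wv.
by rewrite mem_cat sw.
Qed.


Variable P : coset_system X W.
Hypothesis PE : forall s, parabolic P s = special (~` [set s]).

(** The letters of a reduced word of an element of all the P s with s in J
    avoid every such s. *)
Lemma coxeter_parabolicsE J : parabolics P J = special (~` J).
Proof.
apply/seteqP; split=> u.
  move=> Ju; have [w [rw wu]] := reduced_gprod u.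
  exists w => // s sw Js; have : special (~` [set s]) (gprod w).
    by rewrite wu -PE; exact: Ju.
  by move/(special_reduced rw)/(_ s sw)/(_ erefl).
case=> w Jw <- s Js; rewrite PE; exists w => // x /Jw nJx xs.
by apply: nJx; rewrite xs.
Qed.

(** Let c be common to the cosets treated so far.  The gate from c to the next
    coset stays in each of the former ones, because these contain c and a
    point of the next coset. *)
Lemma coxeter_helly : finite_set [set: X] -> helly P.
Proof.
move=> /finite_seqP [l lX] Q cQ.
have [g gP] : exists g, forall s, s \in l -> forall u, Q s u -> P s (u^-1 * g).
  elim: l {lX} => [|s l [c cP]]; first by exists 1.
  have [[u Qu]|nQ] := pselect (exists u, Q s u); last first.
    exists c => z; rewrite in_cons => /orP [/eqP -> u Qu|/cP //].
    by case: nQ; exists u.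
  have [g [sg gate]] := special_gate (~` [set s]) (c^-1 * u).
  exists (c * g) => z; rewrite in_cons => /orP [/eqP ->|zl] v Qv.
    have [z0 [uz0 vz0]] := cQ _ _ _ _ Qu Qv.
    have := parabolic_trans uz0 vz0.
    move: sg; rewrite invgM invgK -mulgA -PE => ug uv.
    rewrite -(mulVKg u (c * g)) mulgA; apply: subgroupM ug.
      exact: parabolic_subgroup.
    by rewrite -[u]invgK -invgM; apply: subgroupV => //;
      exact: parabolic_subgroup.
  have [d [vd ud]] := cQ _ _ _ _ Qv Qu.
  have vc := cP z zl v Qv; rewrite PE in vc; rewrite PE mulgA.
  have sz := special_subgroup (~` [set z]).
  apply: (subgroupM sz vc); apply: (gate (c^-1 * d)).
    by rewrite invgM invgK -mulgA mulVKg -PE.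
  rewrite PE in vd; have := subgroupM sz (subgroupV sz vc) vd.
  by rewrite invgM invgK -mulgA mulVKg.
exists g => s u; apply: gP.
by suff : [set` l] s by []; rewrite -lX.
Qed.

Lemma special1P s u : special [set s] u -> u = 1 \/ u = gen s.
Proof.
move=> [w Sw <-]; elim: w Sw => [|x w IH] Sw; first by left.
have -> : x = s by apply: (Sw x); rewrite mem_head.
rewrite /=; case: IH => [z zw|->|->]; first by apply: Sw; rewrite in_cons zw orbT.
  by right; rewrite mulg1.
by left; exact: gen_sq.
Qed.

Lemma coxeter_thin_parabolics : thin_parabolics P.
Proof.
move=> s; have gs S : S s -> special S (gen s).
  by move=> Ss; rewrite specialE; apply: sub_generated; exists s.
exists (gen s); split=> [||u].
- by rewrite coxeter_parabolicsE setCK; exact: gs.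
- by rewrite PE => /special_gen /(_ erefl).
rewrite coxeter_parabolicsE setCK => /special1P [->|->]; [left|right].
  by apply: subgroup1; exact: parabolic_subgroup.
by rewrite mulVg; apply: subgroup1; exact: parabolic_subgroup.
Qed.

Lemma coxeter_residually_generated : residually_generated P.
Proof.
move=> J [i [k [ik nJi nJk]]].
rewrite coxeter_parabolicsE specialE; apply: generated_sub.
  exact: generated_subgroup.
move=> _ [s /= nJs <-]; apply: sub_generated.
have [l [nJl ls]] : exists l, ~ J l /\ s <> l.
  have [si|] := pselect (s = i); last by exists i.
  by exists k; split=> // sk; apply: ik; rewrite -si.
exists l => //; rewrite coxeter_parabolicsE specialE; apply: sub_generated.
by exists s => //; case.
Qed.

Lemma coxeter_core_free : core_free P.
Proof.
move=> g gP; have : parabolics P setT g.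
  by move=> s _; have := gP s 1; rewrite invg1 mul1g mulg1.
rewrite coxeter_parabolicsE setCT => -[[|s w] Sw <-] //.
by case: (Sw s (mem_head _ _)).
Qed.

Theorem coxeter_regular_hypertope : finite_set [set: X] -> regular_hypertope P.
Proof.
move=> finX; apply/regular_hypertopeP; split.
- exact: coxeter_helly.
- exact: coxeter_thin_parabolics.
- exact: coxeter_residually_generated.
- exact: coxeter_core_free.
Qed.

End CoxeterGroup.

(** * The facets of the given hypertope *)

Section Facets.
Variables (I : Type) (B : groupType) (beta : coset_system I B) (j : I).
Local Notation facets := (facets beta j).

Lemma finite_facetsT : finite_set (lcosets (beta j)) -> finite_set [set: facets].
Proof.
move=> /finite_seqP [s sE]; apply/finite_seqP; exists (pmap insub s).
apply/seteqP; split=> // F _ /=; rewrite mem_pmap; apply/mapP.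
exists (val F); last by rewrite valK.
have sP Q : lcosets (beta j) Q -> Q \in s by rewrite sE.
exact/sP/set_valP.
Qed.

Lemma base_facet_fixed (b : B) : parabolics beta setT b ->
  facet_act b (base_facet beta j) = base_facet beta j.
Proof.
move=> Tb; apply: val_inj => /=; rewrite -[RHS]lcoset1.
apply/esym/eq_lcoset; first exact: parabolic_subgroup.
by rewrite invg1 mul1g; exact: Tb.
Qed.

(** A facet $xB_j$ in the $B_i$-orbit of $B_j$ meets $B_i$; by the Helly property
    some g lies in $xB_j$ and in all the $B_i$ at once, and carries $B_j$ to
    $xB_j$. *)
Lemma facet_fully_admissible (A : groupType) (alpha : coset_system facets A)
    (eta : parabolic_action B alpha) (rep : orbit_reps (idx_act eta)) :
  helly beta -> (forall b F, idx_act eta b F = facet_act b F) ->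
  (forall L, rep L = base_facet beta j) -> fully_admissible beta rep.
Proof.
move=> hB actE repE L J F _ JF.
have [x _ xF] := set_valP F.
have JFx i : J i -> exists2 b, beta i b & beta j (x^-1 * b).
  move=> Ji; have [b ib] := JF i Ji; rewrite actE repE => bF; exists b => //.
  have /= bF' := congr1 val bF.
  by apply/(eq_lcoset _ _ (parabolic_subgroup beta j)); rewrite xF bF'.
have [|g gP] := hB (fun i y => J i /\ y = 1 \/ i = j /\ y = x).
  move=> i k _ _ [[Ji ->]|[-> ->]] [[Jk ->]|[-> ->]].
  - by exists 1; split; exact: parabolicVV.
  - by have [b ib xb] := JFx i Ji; exists b; rewrite invg1 mul1g.
  - by have [b kb xb] := JFx k Jk; exists b; rewrite invg1 mul1g.
  - by exists x; split; exact: parabolicVV.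
exists g; first by move=> i Ji; rewrite -[g]mul1g -invg1; apply: gP; left.
rewrite actE repE; apply: val_inj; rewrite /= -xF; apply/esym/eq_lcoset.
  exact: parabolic_subgroup.
by apply: gP; right.
Qed.

Variable lambda : diagonal_labelling beta j.

(** The labelling as a total function of two facets, with a junk value on the
    diagonal. *)
Definition facet_label (F E : facets) : option nat :=
  if pselect (F <> E) is left FE then lambda (facet_pair_class FE) else None.

Lemma facet_labelE (F E : facets) (FE : F <> E) :
  facet_label F E = lambda (facet_pair_class FE).
Proof.
rewrite /facet_label; case: pselect => // FE'; congr (label lambda _).
exact: val_inj.
Qed.

Lemma facet_label_sym F E : facet_label F E = facet_label E F.
Proof.
have [->//|/eqP FE] := eqVneq F E; have EF : E <> F by move=> e; apply: FE.
rewrite (facet_labelE FE) (facet_labelE EF); congr (label lambda _).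
by apply: val_inj => /=; rewrite setUC.
Qed.

Lemma facet_label_ge2 F E n : F != E -> facet_label F E = Some n -> 1 < n.
Proof. by move=> /eqP FE; rewrite (facet_labelE FE); exact: label_ge2. Qed.

Lemma coxeter_relatorsE r : coxeter_relators lambda r <->
  (exists F, r = [:: (F, false); (F, false)]) \/
  (exists F E n, [/\ F != E, facet_label F E = Some n &
     r = flatten (nseq n [:: (F, false); (E, false)])]).
Proof.
split=> -[[F ->]|]; try by left; exists F.
  move=> [F [E [FE [n [FEn ->]]]]]; right; exists F, E, n.
  by split=> //; [exact/eqP|rewrite (facet_labelE FE)].
move=> [F [E [n [/eqP FE FEn ->]]]]; right; exists F, E, FE, n.
by rewrite -(facet_labelE FE).
Qed.

Lemma coxeter_system_hypertope : finite_set (lcosets (beta j)) ->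
  regular_hypertope (coxeter_system lambda).
Proof.
move=> /finite_facetsT; apply: (coxeter_regular_hypertope facet_label_sym
  facet_label_ge2 coxeter_relatorsE) => F.
by rewrite (specialE coxeter_relatorsE).
Qed.
End Facets.

Theorem theorem3p6 (I : Type) (B : groupType) (beta : coset_system I B) (j : I)
    (beta_hypertope : regular_hypertope beta)
    (finite_facets : finite_set (lcosets (beta j)))
    (two_facets : exists F E : facets beta j, F <> E)
    (lambda : diagonal_labelling beta j) :
  (let eta := coxeter_action lambda in
   admissible beta eta (base_reps beta j)
   /\ regular_hypertope (twisting beta eta (base_reps beta j)))
  /\
  (forall (M : set (coxeter_group lambda)) (subM : subgroup M)
      (invM : forall b : B, coxeter_action lambda b @` M = M),
    let N := normal_closure M in
    regular_hypertope (quot_system N (coxeter_system lambda)) ->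
    let eta_N :=
      quot_parabolic_action (coxeter_action lambda)
        (normal_closure_stable invM) in
    admissible beta eta_N (base_reps beta j)
    /\ regular_hypertope (twisting beta eta_N (base_reps beta j))).
Proof.
have [hB _ _ _] := (regular_hypertopeP beta).1 beta_hypertope.
have finX := finite_facetsT finite_facets.
have main (A : groupType) (alpha : coset_system (facets beta j) A)
    (eta : parabolic_action B alpha) (rep : orbit_reps (idx_act eta)) :
    (forall b F, idx_act eta b F = facet_act b F) ->
    (forall L, rep L = base_facet beta j) -> regular_hypertope alpha ->
    admissible beta eta rep /\ regular_hypertope (twisting beta eta rep).
  move=> actE repE alphaP.
  have adm := facet_fully_admissible hB actE repE.
  split; first exact: fully_admissible_admissible.
  apply: twisting_regular_hypertope => // L b Tb.
  by rewrite actE repE; exact: base_facet_fixed.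
split=> [|M subM invM N quotP].
  by apply: main => //; exact: coxeter_system_hypertope.
exact: main.
Qed.
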